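(* There are universal constants $c_1,c_2>0$ such that the following holds. For every compact metric space $(X,d)$ equipped with a Borel probability measure $\mu$, and every integer $t\in\{2,3,\ldots\}$, there exist a compact subset $S\subseteq X$, an ultrametric $\rho$ on $S$, and a Borel probability measure $\nu$ supported on $S$ such that (i) $d(x,y)\le\rho(x,y)\le 32t\,d(x,y)$ for all $x,y\in S$; (ii) for every $x\in X$ and $r\ge 0$, $$\nu(B_d(x,r))\le \mu(B_d(x,c_1tr))^{1-1/t};$$ (iii) for every $y\in S$ and $r>0$, there is $z\in X$ such that $$B_d\left(z,\frac{r}{c_2t}\right)\subseteq B_d(y,r)\quad\text{and}\quad \nu(B_d(y,r))\ge\frac12\,\mu\left(B_d\left(z,\frac{r}{c_2t}\right)\right)^{1-1/t}.$$
   Context: For a metric space $(X,d)$, $x\in X$ and $r\in[0,\infty)$, $B_d(x,r)=\{z\in X: d(x,z)\le r\}$ denotes the closed ball. An ultrametric on a set $S$ is a metric $\rho$ on $S$ satisfying $\rho(x,y)\le\max\{\rho(x,z),\rho(y,z)\}$ for all $x,y,z\in S$. A Borel probability measure $\nu$ supported on $S$ is regarded as a Borel measure on $X$ via $\nu(B)=\nu(B\cap S)$ for Borel $B\subseteq X$. ''Universal constants'' means that $c_1,c_2$ do not depend on $X,d,\mu,t$. *)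

(* Defs.v *)
From HB Require Import structures.
From mathcomp Require Import all_boot all_order all_algebra.
From mathcomp Require Import all_classical all_reals all_analysis.
Set Implicit Arguments. Unset Strict Implicit. Unset Printing Implicit Defensive.
Import Order.TTheory GRing.Theory Num.Theory.
Local Open Scope classical_set_scope.
Local Open Scope ring_scope.

(* The library's measurable types are pointed.  A metric space carrying a
   probability measure is nonempty, so marking a point is no restriction. *)
#[short(type="pmetricType")]
HB.structure Definition PointedMetric (K : numDomainType) :=
  { M of Metric K M & isPointed M }.

Notation borelType X := (g_sigma_algebraType (@open X)).

(* Not the library's [closed_ball], which is the closure of the open ball and
   may be strictly smaller in a general metric space. *)
Definition mclosed_ball (R : numDomainType) (X : metricType R) (x : X) (r : R)
  : set X := [set z | mdist x z <= r].

(* Only the values of [rho] on [S `*` S] are constrained. *)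
Definition metric_on (R : numDomainType) (T : Type) (S : set T)
    (rho : T -> T -> R) : Prop :=
  [/\ forall x y, S x -> S y -> 0 <= rho x y,
      forall x y, S x -> S y -> (rho x y = 0 <-> x = y),
      forall x y, S x -> S y -> rho x y = rho y x
    & forall x y z, S x -> S y -> S z -> rho x z <= rho x y + rho y z].

Definition ultrametric_on (R : numDomainType) (T : Type) (S : set T)
    (rho : T -> T -> R) : Prop :=
  metric_on S rho /\
  forall x y z, S x -> S y -> S z -> rho x y <= Num.max (rho x z) (rho y z).

(* A measure on a measurable set [S] is identified with the measure [nu] on the
   whole space given by [nu B = nu (B `&` S)]. *)
Definition supported_on d (T : measurableType d) (R : realType)
    (nu : set T -> \bar R) (S : set T) : Prop :=
  forall B, measurable B -> nu B = nu (B `&` S).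

(* Main.v *)
Require Import Defs.
From HB Require Import structures.
From mathcomp Require Import all_boot all_order all_algebra.
From mathcomp Require Import finmap.
From mathcomp Require Import all_classical all_reals all_analysis.
From mathcomp Require Import ring lra.
Set Implicit Arguments. Unset Strict Implicit. Unset Printing Implicit Defensive.
Import Order.TTheory GRing.Theory Num.Theory.
Import numFieldNormedType.Exports.
Local Open Scope ring_scope.

(** The skeleton is the set of branches of a tree of clusters, and [nu] is a
    unit flow down that tree. Write theta for 1 - 1/t.

    Discretization. [X] is replaced by finite nets, one for each scale
    [delta n], with [delta n = 4 * delta n.+1]. Net points carry masses that
    add up along a parent map, a net point is at least as heavy as a small full
    ball of [X] around it, and a set of net points is at most as heavy as its
    neighbourhood ([tower_exists]). The first bound is what makes (iii)
    accessible: a nonempty set of net points always outweighs a whole ball,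
    whereas cutting [X] into Borel pieces may leave slivers that are lighter
    than every ball close to them.

    Splitting. Let M bound the masses of the parts of a cluster C in balls of
    the next radius, and give C the potential mass(C) / M^(1/t). The cluster is
    cut greedily. Around a point x whose small ball has the largest mass m, try
    t + 1 concentric radii, the last one being the next radius. Some step
    between consecutive radii multiplies the mass by at most (M/m)^(1/t)
    ([growth_pigeonhole]). The inner ball P of that step becomes a child, the
    outer ball Q is discarded from the rest, and the cutting goes on outside Q.
    The sets Q exhaust C, distinct children are separated by the width of a
    step, and mass(P) / m^(1/t) >= mass(Q) / M^(1/t). Every ball of the
    following radius in P has mass at most m, so the left side is a potential
    of P; and mass(Q) <= M gives mass(Q)^theta >= mass(Q) / M^(1/t) as well.
    Hence the capacities min(mass(P) / m^(1/t), mass(Q)^theta) of the children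
    add up to at least the potential of C, and a weight not exceeding that
    potential can be passed on to the children within their capacities
    ([split_cluster]). The capacity mass(Q)^theta yields (ii). For (iii) the
    weight is passed on to a minimal family of children: either they are all at
    least half saturated, with capacities at least mass(P)^theta, or a single
    child inherits the whole weight and with it the lower bound of C.

    Limit. Realize the weights as lengths of nested subintervals of [0, 1) and
    push Lebesgue measure forward along the map that sends a number to the
    point of its branch ([skeleton_measure]). The distance [rho] of two points
    is the diameter bound of the last level at which they share a cluster; as
    clusters of the next level are separated by a comparable distance divided
    by t, this ultrametric distorts the metric by at most 32 t
    ([rho_ultrametric]). *)

(** * Ratios along a growing sequence *)

Lemma powR_invn_expn (R : realType) (x : R) (t : nat) :
  (0 < t)%N -> 0 <= x -> (x `^ t%:R^-1) ^+ t = x.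
Proof.
move=> t0 x0; rewrite -powR_mulrn ?powR_ge0// -powRrM mulVf ?powRr1//.
by rewrite pnatr_eq0 -lt0n.
Qed.

Lemma powR_conjugate (R : realType) (t : nat) (x : R) :
  (2 <= t)%N -> 0 <= x -> x `^ (1 - t%:R^-1) * x `^ t%:R^-1 = x.
Proof.
move=> t2 x0; rewrite -powRD ?subrK ?powRr1//.
by rewrite oner_eq0.
Qed.

(** If every one of the [t] steps multiplied [G] by more than the [t]-th root of
    [M / G 0], then [G t] would exceed [M]. The ratio is stated without
    division. *)
Lemma growth_pigeonhole (R : realType) (G : nat -> R) (t : nat) (M : R) :
  (0 < t)%N -> 0 < G 0%N -> 0 < M -> G t <= M ->
  exists2 i, (i < t)%N & G i.+1 * G 0%N `^ t%:R^-1 <= G i * M `^ t%:R^-1.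
Proof.
move=> t0 G0 M0 GM; apply: contrapT => nex.
have step i : (i < t)%N -> G i * M `^ t%:R^-1 < G i.+1 * G 0%N `^ t%:R^-1.
  by move=> it; rewrite ltNge; apply/negP => h; apply: nex; exists i.
set a := M `^ _ in step *; set b := G 0%N `^ _ in step *.
have a0 : 0 < a by exact: powR_gt0.
have b0 : 0 < b by exact: powR_gt0.
have grow i : (i < t)%N -> G 0%N * a ^+ i.+1 < G i.+1 * b ^+ i.+1.
  elim: i => [|i IH] it; first by rewrite !expr1; exact: step.
  rewrite exprSr mulrA (lt_trans (y := G i.+1 * b ^+ i.+1 * a)) //.
    by rewrite ltr_pM2r // IH // ltnW.
  rewrite mulrAC [b ^+ i.+2]exprS mulrA ltr_pM2r ?exprn_gt0//.
  exact: step.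
have := grow t.-1; rewrite prednK // => /(_ (leqnn _)).
rewrite !powR_invn_expn ?(ltW M0) ?(ltW G0)// mulrC ltr_pM2r //.
by rewrite ltNge GM.
Qed.

(** * Cutting a weighted finite metric space *)

Lemma ler_sum_pred (R : realType) (T : finType) (p : T -> R) (A B : pred T) :
  (forall x, 0 <= p x) -> (forall x, A x -> B x) ->
  \sum_(x | A x) p x <= \sum_(x | B x) p x.
Proof.
move=> p0 AB; rewrite [leRHS](bigID A) /= -[leLHS]addr0 lerD//; last exact: sumr_ge0.
rewrite le_eqVlt; apply/orP; left; apply/eqP; apply: eq_bigl => x.
by case: (boolP (A x)) => [/AB->|]; rewrite ?andbF.
Qed.

(** The discarded annuli [Q j :\: P j] pay for the separation of the kept pieces
    [P j]. The loss of mass on [Q j] is compensated by the drop from [M] to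
    [m j] of the mass of the heaviest ball, so that the losses of successive
    scales telescope when the lemma is iterated. Pieces are indexed by their
    centres; centres are distinct because each lies in the set [Q] that is
    removed. *)
Lemma greedy_fragmentation (R : realType) (T : finType) (p : T -> R)
    (d : T -> T -> R) (t : nat) (r g M : R) (Y : {set T}) :
  (0 < t)%N -> (forall x, 0 <= p x) -> (forall x, d x x = 0) ->
  (forall x y, d x y = d y x) ->
  (forall x y z, d x z <= d x y + d y z) -> 0 <= r -> 0 <= g -> 0 < M ->
  (forall x, x \in Y -> \sum_(y in Y | d x y <= r + g * t%:R) p y <= M) ->
  exists (J : {set T}) (P Q : T -> {set T}) (m : T -> R),
  [/\ forall j, j \in J ->
        [/\ j \in Y, P j \subset Q j, Q j \subset Y &
            forall y, y \in Q j -> d j y <= r + g * t%:R],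
      forall j, j \in J ->
        [/\ 0 < m j, m j <= \sum_(y in P j) p y,
        (\sum_(y in Q j) p y) * m j `^ t%:R^-1
          <= (\sum_(y in P j) p y) * M `^ t%:R^-1 &
        forall x, x \in P j -> \sum_(y in P j | d x y <= r) p y <= m j],
      forall i j, i \in J -> j \in J -> i != j ->
        forall x y, x \in P i -> y \in P j -> g < d x y
    & \sum_(j in J) \sum_(y in Q j) p y = \sum_(y in Y) p y].
Proof.
move=> t0 p0 dxx dsym dtri r0 g0 M0.
have [n] := ubnP #|Y|; elim: n Y => // n IH Y; rewrite ltnS => cardY HM.
have sump0 (A : pred T) : 0 <= \sum_(y | A y) p y by exact: sumr_ge0.
have psub (A B : pred T) : (forall y, A y -> B y) ->
    \sum_(y | A y) p y <= \sum_(y | B y) p y by exact: ler_sum_pred.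
have [Y0|Y0] := eqVneq (\sum_(y in Y) p y) 0.
  exists finset.set0, (fun=> finset.set0), (fun=> finset.set0), (fun=> 0).
  by split => [j|j|i j|]; rewrite ?inE// big_set0.
have [x0 x0Y px0] : exists2 x, x \in Y & 0 < p x.
  apply: contrapT => nex; move/eqP: Y0; apply; apply: big1 => y yY.
  apply/eqP; rewrite eq_le p0 andbT leNgt; apply/negP => py.
  by apply: nex; exists y.
pose G x i := \sum_(y in Y | d x y <= r + g * i%:R) p y.
(* Maximality makes the mass of the [r]-ball of [x] a bound for all
   [r]-balls of the piece cut around [x]. *)
pose x := [arg max_(x > x0 in Y) G x 0%N]%O.
have [xY xmax] : x \in Y /\ forall z, z \in Y -> G z 0%N <= G x 0%N.
  by rewrite /x; case: Order.TotalTheory.arg_maxP.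
have Gx0 : 0 < G x 0%N.
  apply: lt_le_trans (xmax _ x0Y); rewrite (lt_le_trans px0)// /G.
  by rewrite (bigD1 x0) /= ?lerDl// x0Y dxx mulr0 addr0.
have [i it ratio] := growth_pigeonhole t0 Gx0 M0 (HM _ xY).
pose B k := [set y in Y | d x y <= r + g * k%:R]%SET.
have GB k : G x k = \sum_(y in B k) p y.
  by apply: eq_bigl => y; rewrite inE.
have BY k : B k \subset Y by apply/fintype.subsetP => y; rewrite inE => /andP[].
have Bmono k l : (k <= l)%N -> B k \subset B l.
  move=> kl; apply/fintype.subsetP => y; rewrite !inE => /andP[-> /le_trans]; apply.
  by rewrite lerD2l ler_wpM2l// ler_nat.
have xB k : x \in B k by rewrite inE xY dxx addr_ge0// mulr_ge0.
pose Y' := (Y :\: B i.+1)%SET.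
have Y'Y : Y' \subset Y by exact: subsetDl.
have [||J [P [Q [m [HPQ Hm Hsep Hsum]]]]] := IH Y'.
- apply: leq_trans cardY; apply: proper_card; apply/properP; split => //.
  by exists x => //; rewrite inE xB.
- move=> z zY'; apply: le_trans (HM z (fintype.subsetP Y'Y _ zY')).
  by apply: psub => y /andP[/(fintype.subsetP Y'Y)->].
have xnJ j : j \in J -> (j == x) = false.
  move=> /HPQ[jY' _ _ _]; apply/eqP => jx; move: jY'.
  by rewrite jx inE xB.
exists (x |: J)%SET, (fun j => if j == x then B i else P j),
  (fun j => if j == x then B i.+1 else Q j),
  (fun j => if j == x then G x 0%N else m j).
split.
- move=> j /setU1P[->|jJ].
    rewrite eqxx; split => // [|y]; first exact: Bmono.
    rewrite inE => /andP[_ /le_trans]; apply.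
    by rewrite lerD2l ler_wpM2l// ler_nat.
  rewrite xnJ//; have [jY' PQ QY Qd] := HPQ _ jJ; split => //.
    exact: (fintype.subsetP Y'Y).
  exact: (fintype.subset_trans QY Y'Y).
- move=> j /setU1P[->|jJ]; last by rewrite xnJ//; exact: Hm.
  rewrite eqxx; split => //.
  + by rewrite -GB; apply: psub => y; rewrite mulr0 addr0 => /andP[-> /le_trans];
      apply; rewrite lerDl mulr_ge0.
  + by rewrite -!GB.
  + move=> z /(fintype.subsetP (BY _)) zY; apply: le_trans (xmax z zY).
    by apply: psub => y /andP[/(fintype.subsetP (BY _))->]; rewrite mulr0 addr0.
- have sepx j y z : j \in J -> y \in B i -> z \in P j -> g < d y z.
    move=> jJ; rewrite inE => /andP[_ xy].
    have [_ PQ QY' _] := HPQ _ jJ.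
    move=> /(fintype.subsetP PQ)/(fintype.subsetP QY'); rewrite !inE => /andP[+ zY].
    rewrite zY /= -ltNge => xz.
    have := dtri x y z; rewrite -natr1 mulrDr mulr1 addrA in xz.
    move=> /(lt_le_trans xz) h.
    rewrite -(ltrD2l (r + g * i%:R)); apply: lt_le_trans h _.
    by rewrite lerD2r.
  move=> j k /setU1P[->|jJ] /setU1P[->|kJ].
  + by rewrite eqxx.
  + by rewrite eqxx xnJ// => _ y z; exact: sepx.
  + by rewrite eqxx xnJ// => _ y z yP zB; rewrite dsym; exact: sepx zB yP.
  + by rewrite !xnJ//; exact: Hsep.
- rewrite big_setU1 /=; last first.
    by apply/negP => xJ; have := xnJ _ xJ; rewrite eqxx.
  rewrite eqxx.
  under [X in _ + X]eq_bigr => j jJ do rewrite xnJ//.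
  rewrite Hsum [RHS](bigID (mem (B i.+1))) /=; congr (_ + _).
    by apply: eq_bigl => y; rewrite [RHS]andbC; case: (boolP (y \in B _)) => //
      /(fintype.subsetP (BY _)) ->.
  by apply: eq_bigl => y; rewrite finset.in_setD andbC.
Qed.

(** In a family [K] of minimal cardinality reaching [w], every capacity exceeds
    the surplus over [w]. With two members or more, the sum is more than twice
    the surplus, so the common factor is at least one half. *)
Lemma prune_weights (R : realType) (I : finType) (J : {set I}) (b : I -> R)
    (w : R) :
  0 < w -> w <= \sum_(i in J) b i ->
  exists (K : {set I}) (l : R),
  [/\ K \subset J, 0 < l <= 1, \sum_(i in K) l * b i = w &
      2^-1 <= l \/ exists i, K = [set i]%SET].
Proof.
move=> w0 wJ.
pose ok (K : {set I}) := (K \subset J) && (w <= \sum_(i in K) b i).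
have okJ : ok J by rewrite /ok fintype.subxx.
case: (@arg_minnP _ J ok (fun K => #|K|) okJ) => K /andP[KJ wK] Kmin.
have S0 : 0 < \sum_(i in K) b i by exact: lt_le_trans wK.
exists K, (w / \sum_(i in K) b i); split => //.
- by rewrite divr_gt0//= ler_pdivrMr// mul1r.
- by rewrite -mulr_sumr divfK ?gt_eqF.
have excess i : i \in K -> \sum_(j in K) b j - w < b i.
  move=> iK; rewrite ltrBlDr -ltrBlDl.
  rewrite ltNge; apply/negP => h.
  have Si : \sum_(j in K) b j = b i + \sum_(j in K :\ i) b j by exact: big_setD1.
  have := Kmin (K :\ i)%SET; rewrite (cardsD1 i K) iK add1n ltnn.
  move=> Kmin1; suff /Kmin1 : ok (K :\ i)%SET by [].
  rewrite /ok (fintype.subset_trans (subD1set _ _) KJ) /=.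
  by move: h; rewrite Si; lra.
have [i iK] : exists i, i \in K.
  have [K0|//] := set_0Vmem K; last by case=> i; exists i.
  by move: S0; rewrite K0 big_set0 ltxx.
have [j jKi|K1] := pickP (mem (K :\ i)%SET); last first.
  right; exists i; apply/setP => j; have := K1 j; rewrite /= !inE.
  by case: eqVneq => [->|].
left; move: jKi; rewrite /= !inE => /andP[ji jK].
rewrite ler_pdivlMr// ler_pdivrMl// mulrC.
have bpos k : k \in K -> 0 <= b k.
  by move=> /excess; move/ltW; apply: le_trans; rewrite subr_ge0.
have : b i + b j <= \sum_(k in K) b k.
  rewrite (big_setD1 i)//= lerD2l (big_setD1 j) ?inE ?ji//= lerDl.
  by apply: sumr_ge0 => k; rewrite !inE => /and3P[_ _ /bpos].
have := excess _ iK; have := excess _ jK; lra.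
Qed.

Lemma subdivide_interval (R : realType) (I : eqType) (s : seq I) (w : I -> R)
    (a : R) :
  uniq s -> (forall i, i \in s -> 0 < w i) ->
  exists h : I -> R,
  [/\ forall i, i \in s -> a <= h i /\ h i + w i <= a + \sum_(i <- s) w i,
      forall u, a <= u < a + \sum_(i <- s) w i ->
        exists2 i, i \in s & h i <= u < h i + w i
    & forall i j u, i \in s -> j \in s -> h i <= u < h i + w i ->
        h j <= u < h j + w j -> i = j].
Proof.
elim: s a => [|x s IH] a.
  exists (fun=> a); split => // u; rewrite big_nil addr0 => /andP[au ua].
  by have := le_lt_trans au ua; rewrite ltxx.
move=> /andP[xs us] w0.
have w0s i : i \in s -> 0 < w i by move=> is_; apply: w0; rewrite inE is_ orbT.
have wx : 0 < w x by apply: w0; rewrite mem_head.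
have [h [hb hcov hdis]] := IH (a + w x) us w0s.
have neq i : i \in s -> (i == x) = false.
  by move=> is_; apply/eqP => ix; move: xs; rewrite -ix is_.
have S0 : 0 <= \sum_(i <- s) w i.
  by rewrite big_seq; apply: sumr_ge0 => i /w0s /ltW.
exists (fun i => if i == x then a else h i); split.
- move=> i; rewrite inE big_cons => /predU1P[->|is_].
    by rewrite eqxx lexx addrA lerDl.
  rewrite neq//; have [h1 h2] := hb _ is_; split; last by rewrite addrA.
  by apply: le_trans h1; rewrite lerDl ltW.
- move=> u; rewrite big_cons addrA => /andP[au ub].
  have [ux|ux] := ltP u (a + w x).
    by exists x; rewrite ?mem_head// eqxx au.
  have [|i is_ hi] := hcov u; first by rewrite ux.
  by exists i; rewrite ?inE ?is_ ?orbT// neq.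
- have disx j u : j \in s -> a <= u < a + w x -> h j <= u < h j + w j -> False.
    move=> js /andP[_ h1] /andP[h2 _]; have [h3 _] := hb _ js.
    by have := lt_le_trans h1 (le_trans h3 h2); rewrite ltxx.
  move=> i j u; rewrite !inE => /predU1P[->|is_] /predU1P[->|js] //.
  + by rewrite eqxx neq// => ux uj; case: (disx _ _ js ux uj).
  + by rewrite eqxx neq// => ui ux; case: (disx _ _ is_ ux ui).
  + by rewrite !neq//; exact: hdis.
Qed.

Local Open Scope classical_set_scope.

(** * Balls in a metric space *)

(** Restated for [pmetricType] so that all distances below are instances of one
    and the same structure, which linear arithmetic needs to identify them. *)
Section metric_facts.
Variables (R : realType) (X : pmetricType R).
Implicit Types x y z : X.

Lemma pdistxx x : mdist x x = 0. Proof. exact: mdistxx. Qed.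

Lemma pdistC x y : mdist x y = mdist y x. Proof. exact: metric_sym. Qed.

Lemma pdist_triangle x y z : mdist x z <= mdist x y + mdist y z.
Proof. exact: metric_triangle. Qed.

End metric_facts.

Lemma closed_mclosed_ball (R : realType) (X : pmetricType R) (x : X) (r : R) :
  closed (mclosed_ball x r).
Proof.
move=> y ycl; rewrite /mclosed_ball /= leNgt; apply/negP => rxy.
have e0 : 0 < mdist x y - r by rewrite subr_gt0.
have [|z [xz yz]] := ycl (ball y (mdist x y - r)).
  exact: nbhsx_ballx.
move: yz xz; rewrite ballEmdist /mclosed_ball /=.
have := pdist_triangle x z y; rewrite (pdistC z y); lra.
Qed.

Lemma open_closer (R : realType) (X : pmetricType R) (a b : X) :
  open [set x | mdist x a < mdist x b].
Proof.
rewrite openE => x /= xab; apply/nbhs_ballP.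
exists ((mdist x b - mdist x a) / 2) => /=; first by rewrite divr_gt0// subr_gt0.
move=> y; rewrite ballEmdist /= => xy.
have := pdist_triangle y x a; have := pdist_triangle x y b.
by rewrite (pdistC y x); move: xy; lra.
Qed.

Lemma measurable_open (R : realType) (X : pmetricType R) (O : set X) :
  open O -> measurable (O : set (borelType X)).
Proof. exact: sub_sigma_algebra. Qed.

Lemma measurable_closed (R : realType) (X : pmetricType R) (B : set X) :
  closed B -> measurable (B : set (borelType X)).
Proof.
move=> cB; rewrite -[B]setCK; apply: measurableC.
by apply: sub_sigma_algebra; exact: closed_openC.
Qed.

(** * Towers of nets *)

(** A sequence of finite nets of [X] with a consistent discretization of [mu].
    The masses need not be measures of cells of an actual nested partition of [X];
    the last two fields say how they compare with [mu]. *)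
Record tower (R : realType) (X : pmetricType R) (mu : set (borelType X) -> \bar R)
    (delta : nat -> R) := Tower {
  pts : nat -> finType;
  emb : forall n, pts n -> X;
  par : forall n, pts n.+1 -> pts n;
  mass : forall n, pts n -> R;
  mass_ge0 : forall n (z : pts n), 0 <= mass z;
  mass_root : \sum_(z : pts 0) mass z = 1;
  mass_par : forall n (z : pts n), mass z = \sum_(y | par y == z) mass y;
  dist_par : forall n (y : pts n.+1), mdist (emb y) (emb (par y)) <= delta n;
  ball_mass : forall n (z : pts n),
    (mu (mclosed_ball (emb z) (delta n / 32)) <= (mass z)%:E)%E;
  mass_nbhd : forall n (F : {set pts n}) (B : set X),
    measurable (B : set (borelType X)) ->
    (forall z, z \in F -> (mclosed_ball (emb z) (2 * delta n) `<=` B)%classic) ->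
    ((\sum_(z in F) mass z)%:E <= mu B)%E }.

Arguments pts {R X mu delta} t n : rename.
Arguments emb {R X mu delta t n} : rename.
Arguments par {R X mu delta t n} : rename.
Arguments mass {R X mu delta t n} : rename.

(** A maximal separated subset of a finite set that is [r / 4]-dense. *)
Lemma net_exists (R : realType) (X : pmetricType R) (r : R) :
  compact [set: X] -> 0 < r ->
  exists (T : finType) (e : T -> X),
    (forall x, exists z, mdist x (e z) <= r) /\
    (forall z w, z != w -> 3 / 4 * r <= mdist (e z) (e w)).
Proof.
rewrite compact_cover => cX r0.
have r4 : 0 < r / 4 by rewrite divr_gt0.
have [|x _|D _ Dcov] := cX X setT (fun x => (ball x (r / 4))^°).
- by move=> x _; exact: open_interior.
- by exists x => //; exact: nbhsx_ballx.
pose sep (G : {set D}) := [forall z in G, forall w in G, (z != w) ==>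
  (3 / 4 * r <= mdist (val z) (val w))].
have sep0 : sep finset.set0 by apply/forall_inP => z; rewrite inE.
have [G sepG Gmax] := @arg_maxnP _ finset.set0 sep (fun G => #|G|) sep0.
exists {z : D | z \in G}, (fun z => val (val z)); split; last first.
  move=> z w zw; move/forall_inP/(_ _ (valP z))/forall_inP/(_ _ (valP w)): sepG.
  by move/implyP; apply; apply: contraNneq zw => /val_inj ->.
move=> x; have [d dD xd] := Dcov x Logic.I.
move: xd => /interior_subset; rewrite ballEmdist /= => xd.
pose d' : D := [` dD]%fset.
have [w wG dw] : exists2 w, w \in G & mdist d (val w) <= 3 / 4 * r.
  have [dG|dG] := boolP (d' \in G).
    by exists d' => //; rewrite /= pdistxx mulr_ge0// ?divr_ge0// ltW.
  apply: contrapT => nex.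
  have far w : w \in G -> 3 / 4 * r <= mdist d (val w).
    move=> wG; rewrite leNgt; apply/negP => /ltW h; apply: nex; by exists w.
  have : sep (d' |: G)%SET.
    apply/forall_inP => z /setU1P[->|zG]; apply/forall_inP => w /setU1P[->|wG].
    - by rewrite eqxx.
    - by apply/implyP => _; exact: far.
    - by apply/implyP => _; rewrite pdistC; exact: far.
    - move/forall_inP/(_ _ zG)/forall_inP/(_ _ wG): sepG; exact.
  by move=> /Gmax /=; rewrite cardsU1 dG add1n ltnn.
exists (Sub w wG); rewrite SubK.
have := pdist_triangle x d (val w); rewrite (pdistC x d).
by move: xd dw; lra.
Qed.

(** Ties are broken by the enumeration of [T], which makes the fibres finite
    Boolean combinations of open sets. *)
Lemma nearest_exists (R : realType) (X : pmetricType R) (T : finType)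
    (e : T -> X) : inhabited T ->
  exists near : X -> T,
    (forall z, measurable ([set x | near x = z] : set (borelType X))) /\
    (forall x w, mdist x (e (near x)) <= mdist x (e w)).
Proof.
move=> [i0].
pose mini x z := [forall w, mdist x (e z) <= mdist x (e w)].
have mini_ex x : exists z, mini x z.
  have [z _ zmin] := @Order.TotalTheory.arg_minP _ _ T i0 xpredT
    (fun z => mdist x (e z)) isT.
  by exists z; apply/forallP => w; exact: zmin.
pose rank (z : T) : nat := enum_rank z.
pose near_spec x z := mini x z /\ forall w, mini x w -> (rank z <= rank w)%N.
have /choice[near nearP] x : exists z, near_spec x z.
  have [z0 z0P] := mini_ex x.
  have [z zP zmin] := @arg_minnP _ z0 (mini x) rank z0P.
  by exists z; split.
exists near; split => [z|x w]; last first.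
  by have [/forallP h _] := nearP x; exact: h.
have -> : [set x | near x = z] =
  \bigcap_(w in [set: T]) [set x | mdist x (e z) <= mdist x (e w)] `&`
  \bigcap_(w in [set w | (rank w < rank z)%N]) [set x | mdist x (e z) < mdist x (e w)].
  apply/seteqP; split => x /=.
    move=> <-; have [/forallP nmin nrank] := nearP x; split => [w _|w /= wz] //=.
    rewrite ltNge; apply/negP => h.
    have : mini x w by apply/forallP => v; exact: le_trans h (nmin v).
    by move=> /nrank; rewrite leqNgt wz.
  move=> [h1 h2]; have zmin : mini x z by apply/forallP => w; exact: h1.
  have [/forallP nmin nrank] := nearP x.
  apply/enum_rank_inj/val_inj/eqP; rewrite eqn_leq nrank//= leqNgt; apply/negP.
  by move=> /h2 /=; rewrite ltNge nmin.
apply: measurableI; apply: fin_bigcap_measurable => //.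
- move=> w _; rewrite (_ : [set _ | _] = ~` [set x | mdist x (e w) < mdist x (e z)]).
    by apply: measurableC; apply: measurable_open; exact: open_closer.
  by apply/seteqP; split => x /=; [move=> h; apply/negP; rewrite -leNgt|
    move=> /negP; rewrite -leNgt].
- by move=> w _; apply: measurable_open; exact: open_closer.
Qed.

Lemma measure_fibers (R : realType) d (Y : measurableType d) (mu : probability Y R)
    (T : finType) (g : Y -> T) (F : pred T) :
  (forall z, measurable [set x | g x = z]) ->
  (\sum_(z | F z) fine (mu [set x | g x = z]))%:E = mu [set x | F (g x)].
Proof.
move=> mg.
have main s : uniq s -> measurable [set x | g x \in s] /\
    (\sum_(z <- s) fine (mu [set x | g x = z]))%:E = mu [set x | g x \in s].
  elim: s => [_|z s IH /andP[zs /IH[ms IHs]]].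
    have -> : [set x | g x \in [::]] = set0 by apply/seteqP; split.
    by rewrite big_nil measure0.
  have E : [set x | g x \in z :: s] = [set x | g x = z] `|` [set x | g x \in s].
    by apply/seteqP; split => x /=; rewrite inE => /predU1P.
  rewrite E; split; first exact: measurableU.
  rewrite big_cons EFinD IHs measureU//; last first.
    apply/seteqP; split => x //= [gz]; rewrite gz; exact/negP.
  by rewrite fineK// fin_num_measure.
have [_] := main _ (enum_uniq F).
rewrite big_enum /= => ->; congr (mu _); apply/seteqP; split => x /=;
  by rewrite mem_enum unfold_in.
Qed.

(** An ultrafilter contains the preimage of every neighbourhood of a cluster
    point, for it contains the preimage or its complement. *)
Lemma ultra_limit (R : realType) (U : set_system nat) (u : nat -> R) :
  UltraFilter U -> (forall k, 0 <= u k <= 1) -> exists l : R, u @ U --> l.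
Proof.
move=> UU u01.
have [|p [_ clp]] := @segment_compact R 0 1 (u @ U) _.
  apply: (@filterS _ U _ setT) => [k _|]; last exact: filterT.
  by rewrite /= in_itv /=; exact: u01.
exists p => B Bp /=; have [//|nB] := in_ultra_setVsetC (u @^-1` B) UU.
by have [v []] := clp (~` B) B nB Bp.
Qed.

Section tower_construction.
Variables (R : realType) (X : pmetricType R) (mu : probability (borelType X) R).
Variable delta : nat -> R.
Hypothesis delta_gt0 : forall n, 0 < delta n.
Hypothesis deltaS : forall n, delta n = 4 * delta n.+1.
Variables (T : nat -> finType) (e : forall n, T n -> X).
Variable closest : forall n, X -> T n.
Hypothesis separated : forall n (z w : T n), z != w ->
  3 / 4 * delta n <= mdist (e z) (e w).
Hypothesis closest_le : forall n x, mdist x (e (closest n x)) <= delta n.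
Hypothesis nearest : forall n x (w : T n), mdist x (e (closest n x)) <= mdist x (e w).
Hypothesis measurable_closest : forall n (z : T n),
  measurable ([set x | closest n x = z] : set (borelType X)).

Definition parent_pt n (z : T n.+1) : T n := closest n (e z).

(** The ancestor in [T n] of the point of the net [n + j] that is closest to
    [x]. For fixed [n] it may depend on [j] for ever when [x] is near the
    boundary between two cells. *)
Fixpoint address j n (x : X) : T n :=
  match j with
  | 0 => closest n x
  | j.+1 => parent_pt (address j n.+1 x)
  end.

Lemma closest_eq n x (z : T n) : mdist x (e z) < 3 / 8 * delta n -> closest n x = z.
Proof.
move=> xz; apply/eqP; apply: contraT => nz.
have := separated nz; have := nearest x z.
have := pdist_triangle (e (closest n x)) x (e z); rewrite (pdistC (e (closest n x)) x).
by move: xz; lra.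
Qed.

(** Successive steps add up: 1 + 1/4 + 1/16 + ... = 4/3. *)
Lemma address_dist j n x : mdist x (e (address j n x)) <= 4 / 3 * delta n.
Proof.
elim: j n => [|j IH] n /=.
  by apply: le_trans (closest_le _ _) _; have := delta_gt0 n; lra.
have := IH n.+1; have := closest_le n (e (address j n.+1 x)).
have := pdist_triangle x (e (address j n.+1 x)) (e (address j.+1 n x)).
by rewrite /= /parent_pt (deltaS n); lra.
Qed.

(** The path from [x] up to level [n.+1] has length at most a third of
    [delta n], and 1/32 + 1/3 is below half of the separation constant 3/4. *)
Lemma address_inner j n x (z : T n) :
  mdist (e z) x <= delta n / 32 -> address j n x = z.
Proof.
move=> zx; case: j => [|j] /=; apply: closest_eq.
  by rewrite pdistC; have := delta_gt0 n; lra.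
have := address_dist j n.+1 x.
have := pdist_triangle (e (address j n.+1 x)) x (e z).
rewrite (pdistC (e (address _ _ _)) x) (pdistC x (e z)).
by have := delta_gt0 n; move: zx; have := deltaS n; lra.
Qed.

Lemma measurable_address j n (z : T n) :
  measurable ([set x | address j n x = z] : set (borelType X)).
Proof.
elim: j n z => [|j IH] n z; first exact: measurable_closest.
rewrite (_ : [set _ | _] = \bigcup_(w in [set w | parent_pt w = z])
    [set x | address j n.+1 x = w]).
  by apply: fin_bigcup_measurable => // w _; exact: IH.
apply/seteqP; split => [x <-|x [w /= <- <-]] //.
by exists (address j n.+1 x).
Qed.

Definition address_mass j n (z : T n) : R :=
  fine (mu [set x | address j n x = z]).

Lemma address_mass_sum j n (F : pred (T n)) :
  (\sum_(z | F z) address_mass j z)%:E = mu [set x | F (address j n x)].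
Proof. by apply: measure_fibers => z; exact: measurable_address. Qed.

Lemma address_massS j n (z : T n) :
  address_mass j.+1 z = \sum_(w | parent_pt w == z) address_mass j w.
Proof.
apply: EFin_inj; rewrite address_mass_sum /address_mass fineK; last first.
  by apply: fin_num_measure; exact: measurable_address.
by congr (mu _); apply/seteqP; split => x /= /eqP.
Qed.

Lemma address_mass01 j n (z : T n) : 0 <= address_mass j z <= 1.
Proof.
have m := measurable_address j z.
rewrite /address_mass fine_ge0//= -lee_fin fineK ?fin_num_measure//.
exact: probability_le1.
Qed.

(** The address masses at depth [j] satisfy the required relations, but only
    between depth [j.+1] at level [n] and depth [j] at level [n.+1]. Limits
    along an ultrafilter, taken at a common depth [k] of the finest net, turn
    them into relations between the levels and keep the inequalities. *)
Lemma tower_of_nets : inhabited (tower mu delta).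
Proof.
have [U [UU oU]] := ultraFilterLemma (F := \oo) _.
have /choice[m mP] : forall nz : {n & T n}, exists l : R,
    address_mass (k - tag nz) (tagged nz) @[k --> U] --> l.
  by move=> [n z] /=; apply: ultra_limit => k; exact: address_mass01.
pose mass n (z : T n) := m (existT _ n z).
have massP n z : address_mass (k - n) z @[k --> U] --> @mass n z.
  exact: (mP (existT _ n z)).
have sumP n (F : pred (T n)) :
    \sum_(z | F z) address_mass (k - n) z @[k --> U] --> \sum_(z | F z) mass n z.
  by apply: cvg_big => [|z _]; [exact: add_continuous|exact: massP].
constructor.
refine (@Tower R X mu delta T e parent_pt mass _ _ _ _ _ _).
- move=> n z; apply: (cvgr_to_ge (@massP n z)); apply: nearW => k.
  by have /andP[] := address_mass01 (k - n) z.
- have h : \sum_(z : T 0) address_mass (k - 0) z @[k --> U] --> (1 : R).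
    rewrite (_ : (fun k => _) = (fun=> 1)); first exact: cvg_cst.
    apply/funext => k; apply: EFin_inj; rewrite address_mass_sum.
    by rewrite (_ : [set x | _] = setT) ?probability_setT//; apply/seteqP; split.
  exact: (norm_cvg_unique (sumP _ xpredT) h).
- move=> n z; apply: (norm_cvg_unique (@massP n z)).
  apply: cvg_trans (sumP n.+1 (fun w => parent_pt w == z)).
  apply: near_eq_cvg; apply: oU; exists n.+1 => // k /= nk.
  by rewrite -address_massS subnSK.
- by move=> n y; exact: closest_le.
- move=> n z; rewrite -[leLHS]fineK; last first.
    apply: fin_num_measure; apply: measurable_closed.
    exact: closed_mclosed_ball.
  rewrite lee_fin; apply: (cvgr_to_ge (@massP n z)); apply: nearW => k.
  have mb : measurable (mclosed_ball (e z) (delta n / 32) : set (borelType X)).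
    by apply: measurable_closed; exact: closed_mclosed_ball.
  have ma := measurable_address (k - n) z.
  apply: fine_le; rewrite ?fin_num_measure//.
  apply: le_measure; rewrite ?inE// => x /=; exact: address_inner.
- move=> n F B mB FB; rewrite -[leRHS]fineK ?fin_num_measure// lee_fin.
  apply: (cvgr_to_le (sumP n (mem F))); apply: nearW => k.
  have ma z := measurable_address (k - n) z.
  rewrite -lee_fin address_mass_sum fineK ?fin_num_measure//.
  apply: le_measure; rewrite ?inE//.
    rewrite (_ : [set x | _] = \bigcup_(z in [set z | z \in F])
        [set x | address (k - n) n x = z]).
      by apply: fin_bigcup_measurable => // z _; exact: ma.
    apply/seteqP; split => [x xF|x [z /= zF az]].
      by exists (address (k - n) n x).
    by rewrite az.
  move=> x /FB; apply; rewrite /mclosed_ball /= pdistC.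
  apply: le_trans (address_dist _ _ _) _.
  by have := delta_gt0 n; lra.
Qed.

End tower_construction.

Lemma tower_exists (R : realType) (X : pmetricType R)
    (mu : probability (borelType X) R) (delta : nat -> R) :
  compact [set: X] -> (forall n, 0 < delta n) ->
  (forall n, delta n = 4 * delta n.+1) -> inhabited (tower mu delta).
Proof.
move=> cX delta_gt0 deltaS.
have /choice[N NP] n : exists N : {T : finType & ((T -> X) * (X -> T))%type},
    [/\ forall z w, z != w ->
          3 / 4 * delta n <= mdist ((tagged N).1 z) ((tagged N).1 w),
        forall x, mdist x ((tagged N).1 ((tagged N).2 x)) <= delta n,
        forall x w, mdist x ((tagged N).1 ((tagged N).2 x))
          <= mdist x ((tagged N).1 w)
      & forall z, measurable ([set x | (tagged N).2 x = z] : set (borelType X))].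
  have [T [e [cov sep]]] := net_exists cX (delta_gt0 n).
  have [i0 _] := cov point.
  have [near [mnear nearmin]] := nearest_exists e (inhabits i0).
  exists (existT _ T (e, near)); split => //= x.
  by have [z zx] := cov x; exact: le_trans (nearmin x z) zx.
apply: (@tower_of_nets R X mu delta delta_gt0 deltaS
  (fun n => tag (N n)) (fun n => (tagged (N n)).1) (fun n => (tagged (N n)).2)).
- by move=> n; have [] := NP n.
- by move=> n; have [] := NP n.
- by move=> n; have [] := NP n.
- by move=> n; have [] := NP n.
Qed.

(** * Splitting a cluster *)

Section clusters.
Variables (R : realType) (X : pmetricType R) (mu : set (borelType X) -> \bar R).
Variables (delta : nat -> R) (W : tower mu delta) (t : nat).
Hypothesis t2 : (2 <= t)%N.
Hypothesis delta_gt0 : forall n, 0 < delta n.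
Hypothesis deltaS : forall n, delta n = 4 * delta n.+1.

Let theta : R := 1 - t%:R^-1.
Definition level_radius n : R := 32 * t%:R * delta n.

(** What is preserved down the tree for a cluster [C] of weight [m]: the lower
    bound that gives (iii), the bound of the weight by the potential, for
    which [M] is taken over balls of the next level, and the upper bound by a
    power of the mass of a set [Q] of bounded size, which gives (ii). *)
Definition good_cluster n (C : {set pts W n}) (m : R) : Prop :=
  [/\ 0 < m,
      forall z, z \in C -> 2^-1 * mass z `^ theta <= m,
      exists M, [/\ 0 < M,
        forall x, par x \in C ->
          \sum_(y | (par y \in C) && (mdist (emb x) (emb y) <= level_radius n.+1))
             mass y <= M
        & m * M `^ t%:R^-1 <= \sum_(z in C) mass z]
    & exists (x : pts W n) (Q : {set pts W n}),
        [/\ C \subset Q, forall y, y \in Q -> mdist (emb x) (emb y) <= level_radius n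
          & m <= (\sum_(z in Q) mass z) `^ theta] ].

Lemma mass_preim n (C : pred (pts W n)) :
  \sum_(z | C z) mass z = \sum_(y | C (par y)) mass y.
Proof.
rewrite [RHS](partition_big (@par _ _ _ _ W n) C) //=.
apply: eq_bigr => z zC; rewrite mass_par; apply: eq_bigl => y.
by case: eqVneq => [->|]; rewrite ?zC ?andbF.
Qed.

Lemma mass_par_ge n (y : pts W n.+1) : mass y <= mass (par y).
Proof.
rewrite [leRHS]mass_par (bigD1 y)//= lerDl; apply: sumr_ge0 => ? _; exact: mass_ge0.
Qed.

(** Fragmentation of the children of [C] at radii from
    [16 * t * delta n.+1] to [32 * t * delta n.+1] in [t] steps of width
    [16 * delta n.+1], followed by pruning. *)
Lemma split_cluster n (C : {set pts W n}) m : good_cluster C m ->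
  exists (K : {set pts W n.+1})
    (P : pts W n.+1 -> {set pts W n.+1})
    (w : pts W n.+1 -> R),
  [/\ forall j, j \in K -> good_cluster (P j) (w j),
      forall j z, j \in K -> z \in P j -> par z \in C,
      \sum_(j in K) w j = m &
      forall i j, i \in K -> j \in K -> i != j -> forall x y,
        x \in P i -> y \in P j -> 16 * delta n.+1 < mdist (emb x) (emb y)].
Proof.
move=> [m0 mlow [M [M0 MC mM]] _].
have t0 : (0 < t)%N by exact: ltnW.
have tR : 2 <= t%:R :> R by rewrite ler_nat.
have d1 := delta_gt0 n.+1.
pose Y : {set pts W n.+1} := [set y | par y \in C]%SET.
have sub_sum k (A B : pred (pts W k)) : (forall y, A y -> B y) ->
    \sum_(y | A y) mass y <= \sum_(y | B y) mass y.
  by apply: ler_sum_pred; exact: mass_ge0.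
pose d (x y : pts W n.+1) := mdist (emb x) (emb y).
have rg : 16 * t%:R * delta n.+1 + 16 * delta n.+1 * t%:R = level_radius n.+1.
  by rewrite /level_radius; ring.
(* A ball of the next radius projects into a ball of twice that radius, as
   parents are within [delta n.+1] of their children. *)
have par_sum (A : {set pts W n.+1}) (x : pts W n.+2) : par x \in A ->
    \sum_(y | (par y \in A) && (mdist (emb x) (emb y) <= level_radius n.+2)) mass y
    <= \sum_(y in A | d (par x) y <= 16 * t%:R * delta n.+1) mass y.
  move=> xA; rewrite [leRHS]mass_preim; apply: sub_sum => y /andP[-> xy] /=.
  have := dist_par x; have := dist_par y.
  have := pdist_triangle (emb (par x)) (emb x) (emb (par y)).
  have := pdist_triangle (emb x) (emb y) (emb (par y)).
  rewrite (pdistC (emb (par x)) (emb x)) /d.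
  move: xy; rewrite /level_radius (deltaS n.+1).
  have : 0 <= (t%:R - 2) * delta n.+2 by rewrite mulr_ge0 ?subr_ge0// ltW.
  have := delta_gt0 n.+2; lra.
have [x|x|x y|x y z||||x xY|] :=
  @greedy_fragmentation R (pts W n.+1) (@mass _ _ _ _ W _) d t
  (16 * t%:R * delta n.+1) (16 * delta n.+1) M Y t0.
- exact: mass_ge0.
- exact: pdistxx.
- exact: pdistC.
- exact: pdist_triangle.
- by rewrite !mulr_ge0// ltW.
- by rewrite mulr_ge0// ltW.
- exact: M0.
- rewrite rg; move: xY; rewrite inE => /MC; apply: le_trans.
  by apply: sub_sum => y; rewrite inE.
move=> J [P [Q [mm [HJ Hm Hsep Hsum]]]].
(* The first capacity is the potential of the piece, the second the bound
   by its surroundings. *)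
pose b j := Num.min ((\sum_(y in P j) mass y) / mm j `^ t%:R^-1)
  ((\sum_(y in Q j) mass y) `^ theta).
have sum_ge0 k (A : pred (pts W k)) : 0 <= \sum_(y | A y) mass y.
  by apply: sumr_ge0 => ? _; exact: mass_ge0.
have th0 : 0 <= theta.
  by rewrite subr_ge0 invf_le1 ?ltr0n// ler1n.
have QM j : j \in J -> \sum_(y in Q j) mass y <= M.
  move=> jJ; have [jY _ QY Qd] := HJ _ jJ.
  move: jY; rewrite inE => /MC; apply: le_trans.
  apply: sub_sum => y yQ; have := fintype.subsetP QY _ yQ; rewrite inE => -> /=.
  by rewrite -rg; exact: Qd.
have bP j : j \in J -> (\sum_(y in P j) mass y) `^ theta <= b j.
  move=> jJ; have [mm0 mmP _ _] := Hm _ jJ; have [_ PQ _ _] := HJ _ jJ.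
  rewrite le_min; apply/andP; split.
    rewrite ler_pdivlMr ?powR_gt0//.
    rewrite -[leRHS](powR_conjugate t2)//; apply: ler_wpM2l; first exact: powR_ge0.
    by apply: ge0_ler_powR; rewrite ?nnegrE ?invr_ge0// ltW.
  apply: ge0_ler_powR; rewrite ?nnegrE//.
  by apply: sub_sum => y; exact: (fintype.subsetP PQ).
have bQ j : j \in J -> (\sum_(y in Q j) mass y) / M `^ t%:R^-1 <= b j.
  move=> jJ; have [mm0 mmP ratio _] := Hm _ jJ.
  rewrite le_min; apply/andP; split.
    by rewrite ler_pdivrMr ?powR_gt0// mulrAC ler_pdivlMr ?powR_gt0.
  rewrite ler_pdivrMr ?powR_gt0//.
  rewrite -[leLHS](powR_conjugate t2)//; apply: ler_wpM2l; first exact: powR_ge0.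
  by apply: ge0_ler_powR; rewrite ?nnegrE ?invr_ge0 ?QM// ltW.
have mb : m <= \sum_(j in J) b j.
  apply: (@le_trans _ _ (\sum_(j in J) (\sum_(y in Q j) mass y) / M `^ t%:R^-1)).
    rewrite -mulr_suml Hsum ler_pdivlMr ?powR_gt0//; apply: le_trans mM _.
    by rewrite mass_preim; apply: sub_sum => y; rewrite inE.
  by apply: ler_sum => j; exact: bQ.
have [K [l [KJ /andP[l0 l1] Ksum Kl]]] := prune_weights m0 mb.
have inJ j : j \in K -> j \in J by exact: (fintype.subsetP KJ).
have parC j z : j \in J -> z \in P j -> par z \in C.
  move=> /HJ[_ PQ QY _] /(fintype.subsetP PQ)/(fintype.subsetP QY).
  by rewrite inE.
exists K, P, (fun j => l * b j); split => //.
- move=> j jK; have jJ := inJ _ jK.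
  have [mm0 mmP ratio mmd] := Hm _ jJ; have [jY PQ QY Qd] := HJ _ jJ.
  have b0 : 0 < b j.
    apply: lt_le_trans (bP _ jJ); apply: powR_gt0; exact: lt_le_trans mmP.
  have lb : l * b j <= b j by rewrite ger_pMl.
  split.
  + by rewrite mulr_gt0.
  + move=> z zP; have [l2|[i Ki]] := Kl.
      apply: ler_pM => //; first exact: powR_ge0.
      apply: le_trans (bP _ jJ); apply: ge0_ler_powR; rewrite ?nnegrE// ?mass_ge0//.
      rewrite (bigD1 z)//= lerDl; exact: sum_ge0.
    (* A single child inherits the weight of [C] and its lower bound, as a
   point is at most as heavy as its parent. *)
    move: jK Ksum; rewrite Ki inE => /eqP <-; rewrite big_set1 => ->.
    apply: le_trans (mlow _ (parC _ _ jJ zP)); rewrite ler_pM2l//.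
    by apply: ge0_ler_powR; rewrite ?nnegrE ?mass_ge0// mass_par_ge.
  + exists (mm j); split => //.
      by move=> x xP; apply: le_trans (mmd _ xP); exact: par_sum.
    rewrite -ler_pdivlMr ?powR_gt0//; apply: le_trans lb _.
    by rewrite ge_min lexx.
  + exists j, (Q j); split => //; first by rewrite -rg.
    by apply: le_trans lb _; rewrite ge_min lexx orbT.
- by move=> j z /inJ; exact: parC.
- by move=> i j /inJ iJ /inJ jJ; exact: Hsep.
Qed.
End clusters.

(** * The measure carried by the branches of a tree *)

Section unit_interval_measure.
Variable R : realType.

Definition unit_itv : set (measurableTypeR R) := `[0, 1[.

Lemma measurable_unit_itv : measurable unit_itv.
Proof. exact: measurable_itv. Qed.

Definition unit_measure : set (measurableTypeR R) -> \bar R :=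
  mrestr (@lebesgue_measure R) measurable_unit_itv.

HB.instance Definition _ := Measure.on unit_measure.

Lemma unit_measureT : unit_measure [set: _] = 1%E.
Proof.
rewrite /unit_measure /mrestr setTI lebesgue_measure_itv /= lte_fin ltr01.
by rewrite sube0.
Qed.

HB.instance Definition _ :=
  Measure_isProbability.Build _ _ _ unit_measure unit_measureT.

Lemma unit_measure_itv (a b : R) : 0 <= a -> a < b -> b <= 1 ->
  unit_measure `[a, b[ = (b - a)%:E.
Proof.
move=> a0 ab b1; rewrite /unit_measure /mrestr setIidl.
  by rewrite lebesgue_measure_itv /= lte_fin ab EFinB.
move=> x /=; rewrite /unit_itv /= !in_itv /= => /andP[ax xb].
by rewrite (le_trans a0 ax) (lt_le_trans xb b1).
Qed.

End unit_interval_measure.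

Lemma borel_pushforward (R : realType) (X : pmetricType R)
    (f : measurableTypeR R -> X) :
  (forall O : set X, open O -> measurable (f @^-1` O)) ->
  exists nu : probability (borelType X) R,
    forall B, nu B = unit_measure (f @^-1` B).
Proof.
move=> mf.
have mg : measurable_fun [set: measurableTypeR R] (f : _ -> borelType X).
  apply: (@measurability _ _ (measurableTypeR R) (borelType X) setT f
    (@open X) erefl).
  by move=> _ [U oU <-]; rewrite setTI; exact: mf.
pose g : {mfun measurableTypeR R >-> borelType X} :=
  HB.pack (f : measurableTypeR R -> borelType X)
    (isMeasurableFun.Build _ _ _ _ (f : _ -> borelType X) mg).
by exists (distribution (@unit_measure R) g).
Qed.

Section tree_limit.
Variables (R : realType) (X : pmetricType R).
Variables (node : nat -> choiceType) (tree : forall n, set (node n)).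
Variables (V : forall n, node n -> set X) (lo wt : forall n, node n -> R).
Variable diam : nat -> R.

Definition slot n (nd : node n) : set R :=
  [set u | lo nd <= u < lo nd + wt nd].

Hypothesis tree_fin : forall n, finite_set (@tree n).
Hypothesis V_closed : forall n (nd : node n), tree nd -> closed (V nd).
Hypothesis V_nonempty : forall n (nd : node n), tree nd -> V nd !=set0.
Hypothesis V_diam : forall n (nd : node n) x y, tree nd -> V nd x -> V nd y ->
  mdist x y <= diam n.
Hypothesis diam0 : forall e, 0 < e -> exists n, diam n < e.
Hypothesis parent : forall n (c : node n.+1), tree c ->
  exists p : node n, [/\ tree p, V c `<=` V p & slot c `<=` slot p].
Hypothesis slot_cover : forall n u, unit_itv u ->
  exists nd : node n, tree nd /\ slot nd u.
Hypothesis slot_disj : forall n (nd nd' : node n) u, tree nd -> tree nd' ->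
  slot nd u -> slot nd' u -> nd = nd'.
Hypothesis slot_unit : forall n (nd : node n), tree nd ->
  [/\ 0 <= lo nd, 0 < wt nd & lo nd + wt nd <= 1].
Hypothesis cptX : compact [set: X].

(** All branches of the tree are taken, which makes this set closed. Branches
    along which the slots shrink to an excluded right endpoint carry no number
    of [0, 1), so the image of the branch map may be smaller. *)
Definition skeleton : set X :=
  [set x | forall n, exists2 nd : node n, tree nd & V nd x].

Lemma skeleton_closed : closed skeleton.
Proof.
have -> : skeleton = \bigcap_n \bigcup_(nd in @tree n) V nd.
  apply/seteqP; split => x xS n; first by move=> _; have [nd] := xS n; exists nd.
  by have [nd] := xS n Logic.I; exists nd.
apply: closed_bigI => n _; apply: closed_bigcup => //.
by move=> nd; exact: V_closed.
Qed.

Lemma skeleton_compact : compact skeleton.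
Proof. by apply: subclosed_compact cptX _ => //; exact: skeleton_closed. Qed.

(** The regions of the nodes whose slots contain [u] decrease. *)
Lemma branch_point u : unit_itv u ->
  exists x, forall n (nd : node n), tree nd -> slot nd u -> V nd x.
Proof.
move=> u01.
pose W n := [set x | forall nd : node n, tree nd -> slot nd u -> V nd x].
have WE n (nd : node n) : tree nd -> slot nd u -> W n = V nd.
  move=> Tnd ndu; apply/seteqP; split => x; first by apply.
  by move=> xnd nd' Tnd' nd'u; rewrite -(slot_disj Tnd Tnd' ndu nd'u).
have W_ne n : exists x, W n x.
  have [nd [Tnd ndu]] := slot_cover n u01; rewrite (WE _ _ Tnd ndu).
  exact: V_nonempty.
have W_closed n : closed (W n).
  have [nd [Tnd ndu]] := slot_cover n u01; rewrite (WE _ _ Tnd ndu).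
  exact: V_closed.
have WS n : W n.+1 `<=` W n.
  have [nd [Tnd ndu]] := slot_cover n.+1 u01; rewrite (WE _ _ Tnd ndu).
  have [p [Tp Vp slotp]] := parent Tnd.
  by rewrite (WE _ _ Tp (slotp _ ndu)).
have Wle n k : (n <= k)%N -> W k `<=` W n.
  move=> /subnK <-; elim: (k - n)%N => // j IH.
  by rewrite addSn; exact: (subset_trans (@WS _)).
have [x xW] := choice W_ne.
have [p [_ clp]] := cptX (F := x @ \oo) _ filterT.
exists p => n nd Tnd ndu; rewrite -(WE _ _ Tnd ndu); apply: W_closed => B Bp.
apply: clp => //; exists n => // k /= nk; exact: Wle nk _ (xW k).
Qed.

(** The branch map is Borel: as diameters tend to 0, the preimage of an open set
    is the union of the slots that it contains, finitely many at each level. *)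
Lemma skeleton_measure : exists nu : probability (borelType X) R,
  [/\ nu (~` skeleton) = 0%E,
      forall n (nd : node n) (B : set X), tree nd -> closed B ->
        (forall (nd' : node n) x,
           tree nd' -> V nd' x -> B x -> skeleton x -> nd' = nd) ->
        (nu B <= (wt nd)%:E)%E
    & forall n (nd : node n) (B : set X), tree nd -> closed B -> V nd `<=` B ->
        ((wt nd)%:E <= nu B)%E].
Proof.
have [F FV] : exists F : R -> X, forall u, @unit_itv R u ->
    forall n (nd : node n), tree nd -> slot nd u -> V nd (F u).
  suff /choice[F FV] : forall u, exists x, @unit_itv R u ->
    forall n (nd : node n), tree nd -> slot nd u -> V nd x by exists F.
  move=> u; have [/branch_point[x xV]|nu] := pselect (@unit_itv R u).
    by exists x.
  by exists point.
have mslot n (nd : node n) : measurable (slot nd : set (measurableTypeR R)).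
  have -> : slot nd = `[lo nd, lo nd + wt nd[.
    by apply/seteqP; split => u; rewrite /slot /= in_itv.
  exact: measurable_itv.
have slot01 n (nd : node n) : tree nd -> slot nd `<=` @unit_itv R.
  move=> /slot_unit[l0 w0 l1] u; rewrite /slot /unit_itv /= in_itv /=.
  by move=> /andP[lu ul]; rewrite (le_trans l0 lu) (lt_le_trans ul l1).
pose f (u : R) := if 0 <= u < 1 then F u else F 0.
have mF : forall U : set X, open U -> measurable (F @^-1` U `&` unit_itv (R := R)).
  move=> U oO.
  have -> : F @^-1` U `&` unit_itv (R := R) =
    \bigcup_n \bigcup_(nd in [set nd : node n | tree nd /\ slot nd `<=` F @^-1` U])
      slot nd.
    apply/seteqP; split => [u [/= Ou u01]|u [n _ [nd /= [Tnd ndO] ndu]]]; last first.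
      by split; [exact: ndO|exact: slot01 Tnd _ ndu].
    have /nbhs_ballP[e /= e0 eO] : nbhs (F u) U by exact: open_nbhs_nbhs.
    have [n dn] := diam0 e0; exists n => //.
    have [nd [Tnd ndu]] := slot_cover n u01.
    exists nd => //; split => // v ndv; apply: eO; rewrite ballEmdist /=.
    apply: le_lt_trans dn; apply: (V_diam Tnd); apply: FV => //.
    exact: slot01 ndv.
  apply: bigcup_measurable => n _; apply: fin_bigcup_measurable.
    by apply: sub_finite_set (tree_fin n) => nd [].
  by move=> nd _; exact: mslot.
have mf : forall U : set X, open U -> measurable (f @^-1` U : set (measurableTypeR R)).
  move=> U oO; have -> : f @^-1` U = (F @^-1` U `&` unit_itv (R := R)) `|`
      (~` unit_itv (R := R) `&` [set u | U (F 0)]).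
    apply/seteqP; split => u /=; rewrite /f /unit_itv /= in_itv /=.
      by case: ifPn => [u01 Uu|/negP u01 Uu]; [left|right].
    by move=> [[Uu ->]|[/negP/negbTE -> ]].
  apply: measurableU; first exact: mF.
  apply: measurableI; first by apply: measurableC; exact: (@measurable_unit_itv R).
  by have [H|H] := pselect (U (F 0)); [rewrite (_ : [set _ | _] = setT)|
    rewrite (_ : [set _ | _] = set0)]; rewrite // ?predeqE.
have [nu nuE] := borel_pushforward mf.
have u0 : @unit_itv R 0 by rewrite /unit_itv /= in_itv /= lexx ltr01.
have fV u n (nd : node n) : @unit_itv R u -> tree nd -> slot nd u -> V nd (f u).
  by move=> u01; rewrite /f ifT; [exact: FV|by move: u01; rewrite /unit_itv /= in_itv].
have Fskel u : @unit_itv R u -> skeleton (F u).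
  by move=> u01 n; have [nd [Tnd ndu]] := slot_cover n u01;
    exists nd => //; exact: FV.
have fskel u : skeleton (f u).
  rewrite /f; case: ifPn => [u01|_]; last exact: (Fskel 0 u0).
  by apply: (Fskel u _); rewrite /unit_itv /= in_itv.
have mpre (B : set X) : closed B -> measurable (f @^-1` B : set (measurableTypeR R)).
  move=> cB; rewrite -[B]setCK -preimage_setC; apply: measurableC; apply: mf.
  exact: closed_openC.
have wslot n (nd : node n) : tree nd -> (wt nd)%:E = unit_measure (slot nd).
  move=> /slot_unit[l0 w0 l1].
  have -> : slot nd = `[lo nd, lo nd + wt nd[.
    by apply/seteqP; split => u; rewrite /slot /= in_itv.
  by rewrite unit_measure_itv ?ltrDl// addrAC subrr add0r.
exists nu; split.
- rewrite nuE (_ : _ @^-1` _ = set0) ?measure0//.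
  by apply/seteqP; split => u //=; apply; exact: fskel.
- move=> n nd B Tnd cB HB; rewrite nuE wslot// /unit_measure /mrestr.
  apply: le_measure; rewrite ?inE.
  + by apply: measurableI; [exact: mpre|exact: (@measurable_unit_itv R)].
  + by apply: measurableI; [exact: mslot|exact: (@measurable_unit_itv R)].
  move=> u [Bu u01]; split => //.
  have [nd' [Tnd' nd'u]] := slot_cover n u01.
  by rewrite -(HB _ _ Tnd' (fV _ _ _ u01 Tnd' nd'u) Bu (fskel u)).
- move=> n nd B Tnd cB VB; rewrite nuE wslot//.
  apply: le_measure; rewrite ?inE//; first exact: mpre.
  move=> u ndu; apply: VB; apply: fV => //; exact: slot01 ndu.
Qed.

End tree_limit.

(** * The tree of clusters *)

Lemma least_nat (P : nat -> Prop) : (exists n, P n) ->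
  exists n, P n /\ forall k, (k < n)%N -> ~ P k.
Proof.
move=> [n Pn]; have ex : exists n, `[< P n >] by exists n; apply/asboolP.
case: (ex_minnP ex) => m /asboolP Pm min_m; exists m; split => // k km Pk.
by have := min_m k (asboolT Pk); rewrite leqNgt km.
Qed.

Section tree_of_clusters.
Variables (R : realType) (X : pmetricType R) (mu : probability (borelType X) R).
Variables (delta : nat -> R) (W : tower mu delta) (t : nat).
Hypothesis t2 : (2 <= t)%N.
Hypothesis delta_gt0 : forall n, 0 < delta n.
Hypothesis deltaS : forall n, delta n = 4 * delta n.+1.
Hypothesis radius0 : forall x y : X, mdist x y <= level_radius delta t 0.

(** A cluster with the left end of its slot and its weight. *)
Definition node n : choiceType := ({set pts W n} * (R * R))%type.
Definition carrier n (nd : node n) : {set pts W n} := nd.1.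
Definition start n (nd : node n) : R := nd.2.1.
Definition weight n (nd : node n) : R := nd.2.2.

(** The radius [2 * delta n] absorbs the displacements from all finer nets, so
    that the region of a child lies in that of its parent. *)
Definition region n (nd : node n) : set X :=
  \bigcup_(z in [set z | z \in carrier nd]) mclosed_ball (emb z) (2 * delta n).

Definition is_split n (nd : node n) (A : set (node n.+1)) : Prop :=
  [/\ finite_set A,
      forall c, A c -> [/\ good_cluster t (carrier c) (weight c),
        forall z, z \in carrier c -> par z \in carrier nd,
        start nd <= start c & start c + weight c <= start nd + weight nd],
      forall u, slot start weight nd u -> exists2 c, A c & slot start weight c u,
      forall c c' u, A c -> A c' ->
        slot start weight c u -> slot start weight c' u -> c = c'
    & forall c c' x y, A c -> A c' -> c <> c' ->
        x \in carrier c -> y \in carrier c' ->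
        16 * delta n.+1 < mdist (emb x) (emb y)].

Lemma split_exists n (nd : node n) :
  good_cluster t (carrier nd) (weight nd) -> exists A, is_split nd A.
Proof.
move=> /(split_cluster t2 delta_gt0 deltaS)[K [P [w [Kc Kpar Ksum Ksep]]]].
have wK j : j \in enum K -> 0 < w j by rewrite mem_enum => /Kc[].
have [h [hb hcov hdis]] := subdivide_interval (start nd) (enum_uniq K) wK.
rewrite big_enum /= Ksum in hb hcov.
pose c j : node n.+1 := (P j, (h j, w j)).
exists (c @` [set j | j \in K]); split.
- by apply: finite_image; exact: finite_finset.
- move=> _ [j jK <-]; rewrite /carrier /weight /start /c /=.
  have [h1 h2] := hb j (etrans (mem_enum _ _) jK).
  by split => //; [exact: Kc|move=> z; exact: Kpar].
- move=> u /hcov[j]; rewrite mem_enum => jK hj.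
  by exists (c j) => //; exists j.
- move=> _ _ u [i iK <-] [j jK <-] ui uj; congr c.
  by apply: hdis ui uj; rewrite mem_enum.
- move=> _ _ x y [i iK <-] [j jK <-] ij; apply: Ksep => //.
  by apply/eqP => ij'; apply: ij; rewrite ij'.
Qed.

Definition children n (nd : node n) : set (node n.+1) :=
  xget set0 (is_split nd).

Definition root_node : node 0 := ([set: pts W 0]%SET : {set pts W 0}, (0, 1)).

Fixpoint cluster_tree n : set (node n) :=
  match n with
  | 0 => [set root_node]
  | n.+1 => \bigcup_(nd in @cluster_tree n) children nd
  end.

Lemma childrenP n (nd : node n) :
  good_cluster t (carrier nd) (weight nd) -> is_split nd (children nd).
Proof. by move=> /split_exists/(xgetPex set0). Qed.

Lemma sum_root (P : pred (pts W 0)) : \sum_(z | P z) mass z <= 1.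
Proof.
rewrite -(mass_root W) [leRHS](bigID P) /= lerDl.
by apply: sumr_ge0 => z _; exact: mass_ge0.
Qed.

Lemma root_good : good_cluster t (carrier root_node) (weight root_node).
Proof.
have th0 : 0 <= 1 - t%:R^-1 :> R.
  by rewrite subr_ge0 invf_le1 ?ltr0n ?ler1n// ltnW.
have m1 : \sum_(z in carrier root_node) mass z = 1.
  by rewrite -(mass_root W); apply: eq_bigl => z; rewrite /carrier /= finset.in_setT.
split; rewrite /weight /=.
- exact: ltr01.
- move=> z _; apply: (@le_trans _ _ (1 * 1)); last by rewrite mulr1.
  apply: ler_pM; rewrite ?powR_ge0 ?invr_ge0// ?invf_le1 ?ler1n//.
  apply: (@le_trans _ _ (1 `^ (1 - t%:R^-1))); last by rewrite powR1.
  apply: ge0_ler_powR => //.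
  + by rewrite nnegrE mass_ge0.
  + by rewrite nnegrE.
  + by have := sum_root (pred1 z); rewrite big_pred1_eq.
- exists 1; split => //.
    move=> x _; apply: (le_trans _ (sum_root xpredT)).
    rewrite mass_preim.
    rewrite [leRHS](bigID (fun y => (par y \in carrier root_node) &&
      (mdist (emb x) (emb y) <= level_radius delta t 1))) /= lerDl.
    by apply: sumr_ge0 => z _; exact: mass_ge0.
  by rewrite powR1 mulr1 m1.
- have [z _] : exists2 z, z \in carrier root_node & true.
    apply: contrapT => nex; have := oner_neq0 R; rewrite -m1 big1 ?eqxx// => z zr.
    by case: nex; exists z.
  exists z, (carrier root_node); split => //.
  by rewrite m1 powR1.
Qed.

Lemma cluster_tree_good n (nd : node n) :
  cluster_tree nd -> good_cluster t (carrier nd) (weight nd).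
Proof.
elim: n nd => [nd ->|n IH c [nd /IH /childrenP[_ H _ _ _] /H[]//]].
exact: root_good.
Qed.

Lemma cluster_tree_parent n (c : node n.+1) : cluster_tree c ->
  exists nd : node n, [/\ cluster_tree nd, children nd c & is_split nd (children nd)].
Proof.
move=> [nd Tnd ndc]; exists nd; split => //; apply: childrenP.
exact: cluster_tree_good.
Qed.

Lemma cluster_tree_finite n : finite_set (@cluster_tree n).
Proof.
elim: n => [|n IH]; first exact: finite_set1.
by apply: bigcup_finite => // nd /cluster_tree_good/childrenP[].
Qed.

Lemma region_parent n (nd : node n) (c : node n.+1) :
  (forall z, z \in carrier c -> par z \in carrier nd) ->
  region c `<=` region nd.
Proof.
move=> par_c x [z /= zc]; rewrite /mclosed_ball /= => zx.
exists (par z); first exact: par_c.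
rewrite /mclosed_ball /=; have := pdist_triangle (emb (par z)) (emb z) x.
have := dist_par z; rewrite (pdistC (emb (par z)) (emb z)).
move: zx; have := deltaS n; have := delta_gt0 n; lra.
Qed.

(** Siblings have carriers at distance more than 16, in units of [delta n], and
    each of the two neighbourhoods takes 2 of it. Nodes with distinct parents
    are separated by the parents. *)
Lemma region_separated n (nd nd' : node n) x y : cluster_tree nd -> cluster_tree nd' ->
  region nd x -> region nd' y -> nd <> nd' -> 12 * delta n < mdist x y.
Proof.
elim: n nd nd' => [nd nd' -> -> //|n IH c c'].
move=> /cluster_tree_parent[p [Tp pc [_ Hp _ _ Hsep]]].
move=> /cluster_tree_parent[p' [Tp' pc' [_ Hp' _ _ _]]] cx cy cc'.
have [_ parc _ _] := Hp _ pc; have [_ parc' _ _] := Hp' _ pc'.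
have := delta_gt0 n; have := deltaS n.
have [pp'|pp'] := pselect (p = p'); last first.
  have := IH _ _ Tp Tp' (region_parent parc cx) (region_parent parc' cy) pp'.
  lra.
move: cx cy => [z /= zc zx] [z' /= zc' zy].
rewrite -pp' in pc'; have := Hsep _ _ _ _ pc pc' cc' zc zc'.
move: zx zy; rewrite /mclosed_ball /=.
have := pdist_triangle (emb z) x (emb z').
have := pdist_triangle x y (emb z').
rewrite (pdistC y); lra.
Qed.

(** Twice the radius of the carrier plus twice that of the neighbourhoods. *)
Definition region_diam n : R := 2 * level_radius delta t n + 4 * delta n.

Lemma region_diamP n (nd : node n) x y : cluster_tree nd ->
  region nd x -> region nd y -> mdist x y <= region_diam n.
Proof.
move=> /cluster_tree_good[_ _ _ [z0 [Q [CQ Qd _]]]] [z /= zc zx] [z' /= zc' zy].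
have h := Qd _ (fintype.subsetP CQ _ zc).
have h' := Qd _ (fintype.subsetP CQ _ zc').
move: zx zy h h'; rewrite /mclosed_ball /= /region_diam.
have := pdist_triangle x (emb z) y.
have := pdist_triangle (emb z) (emb z') y.
have := pdist_triangle (emb z) (emb z0) (emb z').
rewrite (pdistC x (emb z)) (pdistC (emb z) (emb z0)); lra.
Qed.

Lemma region_closed n (nd : node n) : closed (region nd).
Proof.
apply: closed_bigcup; first exact: finite_finset.
by move=> z _; exact: closed_mclosed_ball.
Qed.

Lemma carrier_nonempty n (nd : node n) : cluster_tree nd -> exists z, z \in carrier nd.
Proof.
move=> /cluster_tree_good[w0 _ [M [M0 _ wM]] _]; apply: contrapT => nex.
have : 0 < \sum_(z in carrier nd) mass z.
  by apply: lt_le_trans wM; rewrite mulr_gt0// powR_gt0.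
by rewrite big1 ?ltxx// => z zc; case: nex; exists z.
Qed.

Lemma slot_root : slot start weight root_node = [set u | 0 <= u < 1].
Proof. by rewrite /slot /start /weight /= add0r. Qed.

Lemma cluster_tree_cover n u : 0 <= u < 1 ->
  exists nd : node n, cluster_tree nd /\ slot start weight nd u.
Proof.
move=> u01; elim: n => [|n [nd [Tnd ndu]]].
  by exists root_node; split => //; rewrite slot_root.
have [_ _ Hcov _ _] := childrenP (cluster_tree_good Tnd).
by have [c ndc cu] := Hcov _ ndu; exists c; split => //; exists nd.
Qed.

Lemma slot_parent n (nd : node n) (c : node n.+1) :
  start nd <= start c -> start c + weight c <= start nd + weight nd ->
  slot start weight c `<=` slot start weight nd.
Proof.
move=> h1 h2 u /andP[cu uc].
by rewrite /slot /= (le_trans h1 cu) (lt_le_trans uc h2).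
Qed.

Lemma cluster_tree_slot_disj n (nd nd' : node n) u :
  cluster_tree nd -> cluster_tree nd' ->
  slot start weight nd u -> slot start weight nd' u -> nd = nd'.
Proof.
elim: n nd nd' => [nd nd' -> -> //|n IH c c'].
move=> /cluster_tree_parent[p [Tp pc [_ Hp _ Hdis _]]].
move=> /cluster_tree_parent[p' [Tp' pc' [_ Hp' _ _ _]]] cu c'u.
have [_ _ h1 h2] := Hp _ pc; have [_ _ h1' h2'] := Hp' _ pc'.
have pp' := IH _ _ Tp Tp' (slot_parent h1 h2 cu) (slot_parent h1' h2' c'u).
by rewrite -pp' in pc'; exact: Hdis pc pc' cu c'u.
Qed.

Lemma cluster_tree_slot_unit n (nd : node n) : cluster_tree nd ->
  [/\ 0 <= start nd, 0 < weight nd & start nd + weight nd <= 1].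
Proof.
move=> Tnd; have [w0 _ _ _] := cluster_tree_good Tnd; split=> //.
  elim: n nd Tnd w0 => [nd -> //|n IH c].
  move=> /cluster_tree_parent[p [Tp pc [_ Hp _ _ _]]] _.
  have [_ _ h _] := Hp _ pc; apply: le_trans h; apply: IH => //.
  by have [] := cluster_tree_good Tp.
elim: n nd Tnd w0 => [nd -> _|n IH c].
  by rewrite /start /weight /= add0r.
move=> /cluster_tree_parent[p [Tp pc [_ Hp _ _ _]]] _.
have [_ _ _ h] := Hp _ pc; apply: (le_trans h); apply: IH => //.
by have [] := cluster_tree_good Tp.
Qed.

(** The bound is a constant multiple of [4 ^- n]. *)
Lemma region_diam_small e : 0 < e -> exists n, region_diam n < e.
Proof.
move=> e0.
have dE n : delta n = delta 0 / 4 ^+ n.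
  elim: n => [|n IH]; first by rewrite expr0 divr1.
  have := deltaS n; rewrite IH exprS => h.
  apply: (@mulfI _ 4) => //; rewrite -h; field.
  by rewrite expf_neq0.
pose c : R := 64 * t%:R + 4.
have rE n : region_diam n = c * delta 0 / 4 ^+ n.
  rewrite /region_diam /level_radius dE /c; field.
  by rewrite expf_neq0.
have cd : 0 < c * delta 0 by rewrite mulr_gt0// /c addr_gt0// mulr_gt0// ltr0n ltnW.
exists (Num.truncn (c * delta 0 / e)).+1.
rewrite rE ltr_pdivrMr ?exprn_gt0// [ltRHS]mulrC -ltr_pdivrMr//.
apply: (lt_trans (truncnS_gt _)).
set N := _.+1; have : (N < 4 ^ N)%N by exact: ltn_expl.
by rewrite -(ltr_nat R) natrX.
Qed.

Hypothesis cptX : compact [set: X].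

Let S : set X := skeleton (@cluster_tree) (@region).
Let tR : 2 <= t%:R :> R. Proof. by rewrite ler_nat. Qed.

Lemma region_diam_gt0 n : 0 < region_diam n.
Proof.
by rewrite /region_diam /level_radius addr_gt0// !mulr_gt0// ltr0n ltnW.
Qed.

Lemma region_diamS n : region_diam n = 4 * region_diam n.+1.
Proof. by rewrite /region_diam /level_radius (deltaS n); ring. Qed.

Lemma region_diam_anti m n : (m <= n)%N -> region_diam n <= region_diam m.
Proof.
move=> /subnK <-; elim: (n - m)%N => // k IH.
rewrite addSn; apply: le_trans IH.
by have := region_diamS (k + m); have := region_diam_gt0 (k + m).+1; lra.
Qed.

Definition same_node n x y :=
  exists2 nd : node n, cluster_tree nd & region nd x /\ region nd y.

Lemma same_root x y : S x -> S y -> same_node 0 x y.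
Proof.
move=> Sx Sy; have [nd Tnd ndx] := Sx 0%N; have [nd' Tnd' nd'y] := Sy 0%N.
by exists nd => //; split => //; move: nd'y; rewrite Tnd Tnd'.
Qed.

Lemma same_sym n x y : same_node n x y -> same_node n y x.
Proof. by move=> [nd Tnd [? ?]]; exists nd. Qed.

Lemma sameS n x y : same_node n.+1 x y -> same_node n x y.
Proof.
move=> [c /(cluster_tree_parent)].
move=> [nd [Tnd ndc [_ H _ _ _]]] [cx cy].
have [_ /(region_parent) H' _ _] := H _ ndc.
by exists nd => //; split; exact: H'.
Qed.

Lemma same_le m n x y : (m <= n)%N -> same_node n x y -> same_node m x y.
Proof.
move=> /subnK <-; elim: (n - m)%N => // k IH.
by rewrite addSn => /sameS.
Qed.

Lemma region_inj n (nd nd' : node n) x : cluster_tree nd -> cluster_tree nd' ->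
  region nd x -> region nd' x -> nd = nd'.
Proof.
move=> Tnd Tnd' ndx nd'x; apply: contrapT => nn.
have := region_separated Tnd Tnd' ndx nd'x nn.
by rewrite pdistxx ltNge mulr_ge0// ltW.
Qed.

Lemma same_trans n x y z : same_node n x z -> same_node n z y -> same_node n x y.
Proof.
move=> [nd Tnd [ndx ndz]] [nd' Tnd' [nd'z nd'y]]; exists nd => //; split => //.
by rewrite (region_inj Tnd Tnd' ndz nd'z).
Qed.

Lemma same_dist n x y : same_node n x y -> mdist x y <= region_diam n.
Proof. by move=> [nd Tnd [ndx ndy]]; exact: region_diamP ndx ndy. Qed.

Lemma not_same_dist n x y : S x -> S y -> ~ same_node n x y ->
  12 * delta n < mdist x y.
Proof.
move=> Sx Sy nxy; have [nd Tnd ndx] := Sx n; have [nd' Tnd' nd'y] := Sy n.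
apply: (region_separated Tnd Tnd' ndx nd'y) => nn.
by apply: nxy; exists nd => //; rewrite {2}nn.
Qed.

(** Distinct points share the root, and no node of diameter less than their
    distance. *)
Lemma split_level x y : S x -> S y -> x <> y ->
  exists n, same_node n x y /\ ~ same_node n.+1 x y.
Proof.
move=> Sx Sy xy.
have d0 : 0 < mdist x y.
  rewrite lt_neqAle mdist_ge0 andbT; apply/eqP => /esym.
  by move/mdist_positivity.
have [|[|n] [nsame minn]] := @least_nat (fun n => ~ same_node n x y).
- have [n rn] := region_diam_small d0; exists n => /same_dist.
  by rewrite leNgt rn.
- by case: nsame; exact: same_root.
- by exists n; split => //; apply: contrapT; exact: minn.
Qed.

Lemma rho_exists : exists rho : X -> X -> R,
  (forall x, rho x x = 0) /\
  forall x y, S x -> S y -> x <> y ->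
    exists2 n, same_node n x y /\ ~ same_node n.+1 x y & rho x y = region_diam n.
Proof.
have /choice[rho H] : forall xy : X * X, exists v : R,
    (xy.1 = xy.2 -> v = 0) /\ (S xy.1 -> S xy.2 -> xy.1 <> xy.2 ->
    exists2 n, same_node n xy.1 xy.2 /\ ~ same_node n.+1 xy.1 xy.2 & v = region_diam n).
  move=> [x y] /=; have [xy|xy] := pselect (x = y).
    by exists 0; split.
  have [[Sx Sy]|nS] := pselect (S x /\ S y); last first.
    by exists 0; split => // Sx Sy; case: nS.
  have [n nP] := split_level Sx Sy xy.
  by exists (region_diam n); split => // _ _ _; exists n.
exists (fun x y => rho (x, y)); split => [x|x y Sx Sy xy].
  by have [/= ->] := H (x, x).
by have [_ /=] := H (x, y); apply.
Qed.

(** Sharing a node of a given level is an equivalence relation on [S], refined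
    as the level grows. The distortion compares [region_diam n], which is
    [(256 * t + 16) * delta n.+1], with the separation
    [12 * delta n.+1] at the next level. *)
Lemma rho_ultrametric (rho : X -> X -> R) :
  (forall x, rho x x = 0) ->
  (forall x y, S x -> S y -> x <> y ->
    exists2 n, same_node n x y /\ ~ same_node n.+1 x y & rho x y = region_diam n) ->
  ultrametric_on S rho /\
  forall x y, S x -> S y -> mdist x y <= rho x y <= 32 * t%:R * mdist x y.
Proof.
move=> rho0 rhoP.
have rho_ge0 x y : S x -> S y -> 0 <= rho x y.
  move=> Sx Sy; have [->|xy] := pselect (x = y); first by rewrite rho0.
  by have [n _ ->] := rhoP x y Sx Sy xy; exact/ltW/region_diam_gt0.
have rhoC x y : S x -> S y -> rho x y = rho y x.
  move=> Sx Sy; have [->//|xy] := pselect (x = y).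
  have [n [nxy nxy'] ->] := rhoP x y Sx Sy xy.
  have [|m [mxy mxy'] ->] := rhoP y x Sy Sx; first by move=> yx; exact: xy.
  congr region_diam; apply/eqP; rewrite eqn_leq; apply/andP; split.
  - rewrite leqNgt; apply/negP => mn; apply: mxy'; apply: same_sym.
    exact: same_le nxy.
  - rewrite leqNgt; apply/negP => mn; apply: nxy'; apply: same_sym.
    exact: same_le mxy.
have ultra x y z : S x -> S y -> S z -> rho x y <= Num.max (rho x z) (rho y z).
  move=> Sx Sy Sz; have [->|xy] := pselect (x = y).
    by rewrite rho0 le_max rho_ge0.
  have [<-|xz] := pselect (x = z); first by rewrite rho0 (rhoC y x)// le_max lexx orbT.
  have [<-|yz] := pselect (y = z); first by rewrite rho0 le_max lexx.
  have [c [cxy cxy'] ->] := rhoP x y Sx Sy xy.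
  have [a [axz _] ->] := rhoP x z Sx Sz xz.
  have [b [byz _] ->] := rhoP y z Sy Sz yz.
  have key k : (k <= a)%N -> (k <= b)%N -> region_diam c <= region_diam k.
    move=> ka kb; apply: region_diam_anti; rewrite leqNgt; apply/negP => ck.
    apply: cxy'; apply: (same_le ck); apply: same_trans (same_le ka axz) _.
    exact/same_sym/(same_le kb byz).
  rewrite le_max; have [ab|/ltnW ba] := leqP a b.
  - by rewrite key.
  - by rewrite (key b)// orbT.
split; first split; first split.
- exact: rho_ge0.
- move=> x y Sx Sy; split => [rxy|->//].
  apply: contrapT => xy; have [n _ rn] := rhoP x y Sx Sy xy.
  by have := region_diam_gt0 n; rewrite -rn rxy ltxx.
- exact: rhoC.
- move=> x y z Sx Sy Sz; apply: le_trans (ultra x z y Sx Sz Sy) _.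
  rewrite ge_max (rhoC z y)//.
  by rewrite lerDl rho_ge0// lerDr rho_ge0.
- exact: ultra.
- move=> x y Sx Sy; have [->|xy] := pselect (x = y).
    by rewrite rho0 pdistxx mulr0 lexx.
  have [n [nxy nxy'] ->] := rhoP x y Sx Sy xy.
  rewrite same_dist//=.
  have h := not_same_dist Sx Sy nxy'.
  apply: (@le_trans _ _ (32 * t%:R * (12 * delta n.+1))); last first.
    by apply: ler_wpM2l; [rewrite mulr_ge0|exact: ltW].
  rewrite /region_diam /level_radius (deltaS n).
  have : 0 <= (t%:R - 2) * delta n.+1 by rewrite mulr_ge0 ?subr_ge0// ltW.
  have := delta_gt0 n.+1; lra.
Qed.

Lemma unit_itvP (u : R) : @unit_itv R u -> 0 <= u < 1.
Proof. by rewrite /unit_itv /= in_itv. Qed.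

Lemma node_parent n (c : node n.+1) : cluster_tree c -> exists p : node n,
  [/\ cluster_tree p, region c `<=` region p &
      slot start weight c `<=` slot start weight p].
Proof.
move=> /cluster_tree_parent[p [Tp pc [_ H _ _ _]]]; exists p.
have [_ parc h1 h2] := H _ pc.
by split => //; [exact: region_parent|exact: slot_parent].
Qed.

Lemma tree_measure : exists nu : probability (borelType X) R,
  [/\ nu (~` S) = 0%E,
      forall n (nd : node n) (B : set X), cluster_tree nd -> closed B ->
        (forall (nd' : node n) x,
           cluster_tree nd' -> region nd' x -> B x -> S x -> nd' = nd) ->
        (nu B <= (weight nd)%:E)%E
    & forall n (nd : node n) (B : set X),
        cluster_tree nd -> closed B -> region nd `<=` B ->
        ((weight nd)%:E <= nu B)%E].
Proof.
apply: (@skeleton_measure R X node (@cluster_tree) (@region) start weight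
  region_diam) => //.
- exact: cluster_tree_finite.
- by move=> n nd _; exact: region_closed.
- move=> n nd /carrier_nonempty[z zc]; exists (emb z); exists z => //.
  by rewrite /mclosed_ball /= pdistxx mulr_ge0// ltW.
- by move=> n nd x y; exact: region_diamP.
- by move=> e; exact: region_diam_small.
- exact: node_parent.
- by move=> n u /unit_itvP; exact: cluster_tree_cover.
- by move=> n nd nd' u; exact: cluster_tree_slot_disj.
- by move=> n nd; exact: cluster_tree_slot_unit.
Qed.

Section balls.
Variable nu : probability (borelType X) R.
Hypothesis nuS : nu (~` S) = 0%E.
Hypothesis nu_le : forall n (nd : node n) (B : set X), cluster_tree nd -> closed B ->
  (forall (nd' : node n) x,
     cluster_tree nd' -> region nd' x -> B x -> S x -> nd' = nd) ->
  (nu B <= (weight nd)%:E)%E.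
Hypothesis nu_ge : forall n (nd : node n) (B : set X), cluster_tree nd -> closed B ->
  region nd `<=` B -> ((weight nd)%:E <= nu B)%E.

Let theta : R := 1 - t%:R^-1.

Let theta_ge0 : 0 <= theta.
Proof. by rewrite subr_ge0 invf_le1 ?ltr0n ?ler1n// ltnW. Qed.

Let S_closed : closed S.
Proof.
apply: skeleton_closed => n; first exact: cluster_tree_finite.
by move=> nd _; exact: region_closed.
Qed.

Let mS : measurable (S : set (borelType X)).
Proof. exact: measurable_closed. Qed.

Lemma skeleton_supported : supported_on nu S.
Proof.
move=> B mB; rewrite (@measureDI _ _ _ nu B S mB mS).
rewrite -[RHS]add0e; congr (_ + _)%E; apply/eqP; rewrite eq_le measure_ge0 andbT.
rewrite -nuS; apply: le_measure; rewrite ?inE.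
- exact: measurableD.
- exact: measurableC.
- by move=> x [].
Qed.

(** Take the first level whose diameter bound is at most [64 * t * r]. At the
    previous level the bound is larger, so two nodes of the present level are
    more than [2 * r] apart and the ball meets the region of only one. The
    weight of that node is at most a power of the mass of points
    whose neighbourhoods lie within [r + 64 * t * r] of [x]. *)
Lemma ball_upper_pos x r : 0 < r ->
  (nu (mclosed_ball x r) <= mu (mclosed_ball x (65 * t%:R * r)) `^ theta)%E.
Proof.
move=> r0.
have t0 : 0 < t%:R :> R by rewrite (lt_le_trans _ tR).
have [[y [By Sy]]|nex] := pselect (exists y, mclosed_ball x r y /\ S y); last first.
  apply: le_trans (poweR_ge0 _ _); rewrite -nuS; apply: le_measure; rewrite ?inE.
  - apply: measurable_closed; exact: closed_mclosed_ball.
  - exact: measurableC.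
  - by move=> y By Sy; apply: nex; exists y.
have [n [rn minn]] : exists n, region_diam n <= 64 * t%:R * r /\
    forall k, (k < n)%N -> ~ (region_diam k <= 64 * t%:R * r).
  apply: least_nat; have [|n /ltW rn] := @region_diam_small (64 * t%:R * r).
    by rewrite !mulr_gt0.
  by exists n.
have [nd Tnd ndy] := Sy n.
have [w0 _ _ [z0 [Q [CQ Qd wQ]]]] := cluster_tree_good Tnd.
apply: (@le_trans _ _ (weight nd)%:E).
  apply: nu_le => // [|nd' x' Tnd' nd'x' Bx' Sx'].
    exact: closed_mclosed_ball.
  apply: contrapT => nn.
  have xx' : mdist x' y <= 2 * r.
    have := pdist_triangle x' x y; rewrite (pdistC x' x).
    by move: By Bx'; rewrite /mclosed_ball /=; lra.
  have := region_separated Tnd' Tnd nd'x' ndy nn.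
  case: n nd Tnd nd' Tnd' rn minn nn {ndy nd'x' w0 z0 Q CQ Qd wQ}
    => [nd Tnd nd' Tnd'|n nd Tnd nd' Tnd'] rn minn nn.
    by move=> _; apply: nn; rewrite Tnd Tnd'.
  have := minn n (ltnSn _) => /negP; rewrite -ltNge.
  rewrite /region_diam /level_radius (deltaS n).
  have : 0 <= (t%:R - 2) * delta n.+1 by rewrite mulr_ge0 ?subr_ge0// ltW.
  move=> h1 h2 h3.
  have : t%:R * r < t%:R * (5 * delta n.+1).
    by have := delta_gt0 n.+1; lra.
  by rewrite ltr_pM2l//; move: h3 xx'; have := delta_gt0 n.+1; lra.
apply: (@le_trans _ _ ((\sum_(z in Q) mass z) `^ theta)%:E); first by rewrite lee_fin.
rewrite -poweR_EFin; apply: gt0_ler_poweR => //.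
- by rewrite in_itv /= lee_fin leey andbT; apply: sumr_ge0 => z _; exact: mass_ge0.
- by rewrite in_itv /= measure_ge0 leey.
apply: mass_nbhd; first by apply: measurable_closed; exact: closed_mclosed_ball.
move=> z zQ w; move: ndy => [z1 /= z1c z1y]; have zd := Qd _ zQ.
have z1d := Qd _ (fintype.subsetP CQ _ z1c).
move: z1y zd z1d By rn; rewrite /mclosed_ball /= /region_diam.
have := pdist_triangle x y w; have := pdist_triangle y (emb z1) w.
have := pdist_triangle (emb z1) (emb z) w.
have := pdist_triangle (emb z1) (emb z0) (emb z).
rewrite (pdistC y (emb z1)) (pdistC (emb z1) (emb z0)).
have : r <= t%:R * r by rewrite ler_peMl// ?ltW// (lt_le_trans _ tR)// ltr1n.
lra.
Qed.

Let theta_gt0 : 0 < theta.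
Proof.
rewrite subr_gt0 invf_lt1 ?ltr0n ?ltr1n//; exact: ltnW.
Qed.

Let theta_neq0 : theta != 0.
Proof. by rewrite gt_eqF. Qed.

(** At radius 0 the bound is the limit of the bounds at positive radii, by
    continuity of [mu] from above. *)
Lemma ball_upper x r : 0 <= r ->
  (nu (mclosed_ball x r) <= mu (mclosed_ball x (65 * t%:R * r)) `^ theta)%E.
Proof.
rewrite le_eqVlt => /predU1P[<-|]; last exact: ball_upper_pos.
rewrite mulr0.
have t0 : 0 < t%:R :> R by rewrite (lt_le_trans _ tR).
have mB s : measurable (mclosed_ball x s : set (borelType X)).
  by apply: measurable_closed; exact: closed_mclosed_ball.
have pos_itv (P : probability (borelType X) R) s :
    P (mclosed_ball x s) \in `[0%E, +oo%E]%R.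
  by rewrite in_itv /= measure_ge0 leey.
have root_le k :
    (nu (mclosed_ball x 0) `^ theta^-1 <= mu (mclosed_ball x k.+1%:R^-1))%E.
  have s0 : 0 < k.+1%:R^-1 / (65 * t%:R) :> R.
    by rewrite divr_gt0// ?invr_gt0 ?ltr0n// mulr_gt0.
  have le1 : (nu (mclosed_ball x 0) <= mu (mclosed_ball x k.+1%:R^-1) `^ theta)%E.
    have := ball_upper_pos x s0; rewrite (mulrC (65 * t%:R)) divfK ?gt_eqF ?mulr_gt0//.
    apply: le_trans; apply: le_measure; rewrite ?inE//.
    by move=> y; rewrite /mclosed_ball /= => /le_trans; apply; exact: ltW.
  have -> : mu (mclosed_ball x k.+1%:R^-1) =
      ((mu (mclosed_ball x k.+1%:R^-1) `^ theta) `^ theta^-1)%E.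
    by rewrite -poweRrM mulfV// poweRe1.
  apply: gt0_ler_poweR => //; first by rewrite invr_ge0 ltW.
  by rewrite in_itv /= poweR_ge0 leey.
have capE : \bigcap_k mclosed_ball x k.+1%:R^-1 = mclosed_ball x 0.
  apply/seteqP; split => y /=; rewrite /mclosed_ball /=; last first.
    by move=> h k _ /=; apply: le_trans h _; rewrite invr_ge0.
  move=> h; rewrite leNgt; apply/negP => d0.
  have := h (Num.truncn (mdist x y)^-1) Logic.I => /=.
  by rewrite leNgt invf_plt ?posrE// ?ltr0n// truncnS_gt.
have lim_mu : mu (mclosed_ball x k.+1%:R^-1) @[k --> \oo] --> mu (mclosed_ball x 0).
  rewrite -capE; apply: (@nonincreasing_cvg_mu _ _ _ mu
      (fun k => mclosed_ball x k.+1%:R^-1)).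
  - by rewrite (le_lt_trans (probability_le1 _ _)) ?ltry.
  - by [].
  - exact: bigcapT_measurable.
  - move=> k l kl; apply/subsetPset => y; rewrite /mclosed_ball /=.
    by move=> /le_trans; apply; rewrite lef_pV2 ?posrE ?ltr0n// ler_nat.
have le_lim : (nu (mclosed_ball x 0) `^ theta^-1 <= mu (mclosed_ball x 0))%E.
  rewrite -(cvg_lim _ lim_mu)//; apply: lime_ge.
    by apply/cvg_ex; eexists; exact: lim_mu.
  by apply: nearW => k; exact: root_le.
have -> : nu (mclosed_ball x 0) = ((nu (mclosed_ball x 0) `^ theta^-1) `^ theta)%E.
  by rewrite -poweRrM mulVf// poweRe1.
apply: gt0_ler_poweR => //.
by rewrite in_itv /= poweR_ge0 leey.
Qed.

(** At the first level whose diameter bound is at most [r], the node of [y] lies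
    in the ball of [y], and any point [z] of its carrier will do. When this is
    level 0 the scale may be far below [r], but then the ball of [y] is the
    whole space. *)
Lemma ball_lower y r : S y -> 0 < r ->
  exists z : X,
    mclosed_ball z (r / (128 * 96 * t%:R)) `<=` mclosed_ball y r /\
    ((2^-1)%:E * (mu (mclosed_ball z (r / (128 * 96 * t%:R)))) `^ theta
      <= nu (mclosed_ball y r))%E.
Proof.
move=> Sy r0.
have t0 : 0 < t%:R :> R by rewrite (lt_le_trans _ tR).
have cB z s : closed (mclosed_ball z s : set X) by exact: closed_mclosed_ball.
have mB z s : measurable (mclosed_ball z s : set (borelType X)).
  exact: measurable_closed.
have [n [rn minn]] : exists n, region_diam n <= r /\
    forall k, (k < n)%N -> ~ (region_diam k <= r).
  apply: least_nat; have [n /ltW rn] := region_diam_small r0.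
  by exists n.
have [nd Tnd ndy] := Sy n.
have reg_ball : region nd `<=` mclosed_ball y r.
  by move=> w ndw; apply: le_trans rn; exact: region_diamP ndw.
have nu_half z : z \in carrier nd ->
    (2^-1%:E * (mass z)%:E `^ theta <= nu (mclosed_ball y r))%E.
  move=> zc; apply: le_trans (nu_ge Tnd (cB _ _) reg_ball).
  have [_ low _ _] := cluster_tree_good Tnd.
  by rewrite poweR_EFin -EFinM lee_fin low.
have half_mono z z' s : (mu (mclosed_ball z' s) <= (mass z)%:E)%E ->
    z \in carrier nd ->
    (2^-1%:E * mu (mclosed_ball z' s) `^ theta <= nu (mclosed_ball y r))%E.
  move=> h zc; apply: le_trans (nu_half z zc).
  apply: lee_wpmul2l; first by rewrite lee_fin invr_ge0.
  apply: gt0_ler_poweR => //.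
  - by rewrite in_itv /= measure_ge0 leey.
  - by rewrite in_itv /= lee_fin mass_ge0 leey.
have [z zc] := carrier_nonempty Tnd.
have d0 := delta_gt0 n.
have small : r / (128 * 96 * t%:R) <= delta n / 32 \/ level_radius delta t 0 <= r.
  case: n {half_mono nu_half reg_ball ndy nd Tnd z zc} rn minn d0 => [|n] rn minn d0.
    right; apply: le_trans rn; rewrite /region_diam /level_radius.
    have : 0 < t%:R * delta 0 by rewrite mulr_gt0.
    by have := delta_gt0 0; lra.
  left; rewrite ler_pdivrMr; last by rewrite mulr_gt0.
  have := minn n (ltnSn _) => /negP; rewrite -ltNge.
  rewrite /region_diam /level_radius (deltaS n).
  have : 0 <= (t%:R - 2) * delta n.+1 by rewrite mulr_ge0 ?subr_ge0// ltW.
  lra.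
have [small_r|big_r] := small; last first.
  have all_ball : mclosed_ball y r = setT.
    by apply/seteqP; split => // w _; exact: le_trans (radius0 _ _) big_r.
  exists y; rewrite all_ball; split => //.
  rewrite probability_setT -[leRHS]mule1; apply: lee_pmul => //.
  - exact: poweR_ge0.
  - by rewrite lee_fin invf_le1// ler1n.
  - rewrite -[leRHS](poweR1r theta); apply: gt0_ler_poweR => //.
    + by rewrite in_itv /= measure_ge0 leey.
    + by rewrite in_itv /= lee01 leey.
    + exact: probability_le1.
exists (emb z); split.
  move=> w zw; apply: reg_ball; exists z => //; rewrite /mclosed_ball /=.
  apply: le_trans zw _; apply: le_trans small_r _.
  by have := delta_gt0 n; lra.
apply: half_mono zc; apply: le_trans (@ball_mass _ _ _ _ W n z).
apply: le_measure; rewrite ?inE//.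
by move=> w zw; exact: le_trans zw small_r.
Qed.

End balls.

Lemma tower_skeleton : exists (S : set X) (rho : X -> X -> R)
    (nu : probability (borelType X) R),
  [/\ compact S, ultrametric_on S rho, supported_on nu S &
  [/\ (forall x y, S x -> S y ->
         mdist x y <= rho x y <= 32 * t%:R * mdist x y),
      (forall (x : X) (r : R), 0 <= r ->
         (nu (mclosed_ball x r)
          <= (mu (mclosed_ball x (65 * t%:R * r))) `^ (1 - t%:R^-1))%E)
    & (forall (y : X) (r : R), S y -> 0 < r ->
         exists z : X,
           mclosed_ball z (r / (128 * 96 * t%:R)) `<=` mclosed_ball y r /\
           ((2^-1)%:E * (mu (mclosed_ball z (r / (128 * 96 * t%:R)))) `^ (1 - t%:R^-1)
            <= nu (mclosed_ball y r))%E)]].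
Proof.
have [nu [nuS nu_le nu_ge]] := tree_measure.
have [rho [rho0 rhoP]] := rho_exists.
have [ultra dist] := rho_ultrametric rho0 rhoP.
exists S, rho, nu; split => //.
- apply: skeleton_compact => //; first by move=> n; exact: cluster_tree_finite.
  by move=> n nd _; exact: region_closed.
- exact: skeleton_supported.
- by split => //; [exact: ball_upper|exact: ball_lower].
Qed.

End tree_of_clusters.

(** * The theorem *)

Lemma compact_bounded (R : realType) (X : pmetricType R) :
  compact [set: X] -> exists2 D : R, 0 < D & forall x y : X, mdist x y <= D.
Proof.
move=> /net_exists/(_ ltr01)[T [e [cov _]]].
have D0 : 0 <= \sum_z \sum_w mdist (e z) (e w).
  by apply: sumr_ge0 => z _; apply: sumr_ge0 => w _; exact: mdist_ge0.
exists (2 + \sum_z \sum_w mdist (e z) (e w)); first by rewrite ltr_wpDr.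
move=> x y; have [z xz] := cov x; have [w yw] := cov y.
have zw : mdist (e z) (e w) <= \sum_z \sum_w mdist (e z) (e w).
  rewrite (bigD1 z)//= (bigD1 w)//= -addrA lerDl addr_ge0//.
    by apply: sumr_ge0 => v _; exact: mdist_ge0.
  by apply: sumr_ge0 => v _; apply: sumr_ge0 => v' _; exact: mdist_ge0.
have := pdist_triangle x (e z) y; have := pdist_triangle (e z) (e w) y.
by rewrite (pdistC (e w) y); lra.
Qed.

Theorem theorem1p1 (R : realType) :
  exists c1 c2 : R, [/\ 0 < c1, 0 < c2 &
    forall (X : pmetricType R) (mu : probability (borelType X) R) (t : nat),
    compact [set: X] -> (2 <= t)%N ->
    exists (S : set X) (rho : X -> X -> R)
           (nu : probability (borelType X) R),
    [/\ compact S, ultrametric_on S rho, supported_on nu S &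
    [/\ (forall x y, S x -> S y ->
           mdist x y <= rho x y <= 32 * t%:R * mdist x y),
        (forall (x : X) (r : R), 0 <= r ->
           (nu (mclosed_ball x r)
            <= (mu (mclosed_ball x (c1 * t%:R * r))) `^ (1 - t%:R^-1))%E)
      & (forall (y : X) (r : R), S y -> 0 < r ->
           exists z : X,
             mclosed_ball z (r / (c2 * t%:R)) `<=` mclosed_ball y r /\
             ((2^-1)%:E * (mu (mclosed_ball z (r / (c2 * t%:R)))) `^ (1 - t%:R^-1)
              <= nu (mclosed_ball y r))%E)]]].
Proof.
exists 65, (128 * 96); split; [by []|by rewrite mulr_gt0|].
move=> X mu t cX t2; have [D D0 XD] := compact_bounded cX.
have t0 : 0 < t%:R :> R by rewrite ltr0n ltnW.
pose delta n : R := D / (32 * t%:R) / 4 ^+ n.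
have delta_gt0 n : 0 < delta n by rewrite !divr_gt0// ?mulr_gt0// exprn_gt0.
have deltaS n : delta n = 4 * delta n.+1.
  by rewrite /delta exprS; field; rewrite !gt_eqF// exprn_gt0.
have [W] := tower_exists mu cX delta_gt0 deltaS.
apply: (tower_skeleton W t2 delta_gt0 deltaS _ cX) => x y.
by rewrite /level_radius /delta expr0 divr1 mulrC divfK// gt_eqF// mulr_gt0.
Qed.
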